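(* Let $\Delta$ be a building whose apartments are isomorphic to the Coxeter complex of a Coxeter system $(W,S)$ such that $W$ is word hyperbolic. Then the dual graph $\Delta'$ of $\Delta$ is a hyperbolic metric space.
   Context: Coxeter systems $(W,S)$ have $S$ finite. Buildings are simplicial complexes that are unions of apartments in the usual sense (thickness and local finiteness are not assumed). Dual graph: $\Delta'$ is the graph whose vertices are (the barycenters of) the chambers of $\Delta$, two distinct chambers being joined by an edge when they have a common codimension-one face (which is the empty face if $|S|=1$). Each edge of $\Delta'$ is taken to be isometric to the unit interval, and $\Delta'$ carries the induced path metric. Hyperbolicity: a geodesic metric space $(X,d)$ is one in which any two points are joined by a path realizing their distance (a geodesic). It is $\delta$-hyperbolic if whenever $P$ is a point on side $\alpha$ of a geodesic triangle with sides $\alpha,\beta,\gamma$, there is a point $Q$ on $\beta\cup\gamma$ with $d(P,Q)\le\delta$; it is hyperbolic if it is $\delta$-hyperbolic for some $\delta$. A finitely generated group is (word) hyperbolic if its Cayley graph with respect to some (equivalently, any) finite generating set, with edges of length one, is hyperbolic. *)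

(* Defs.v *)
From HB Require Import structures.
From mathcomp Require Import all_boot all_order all_algebra finmap.
From mathcomp Require Import all_classical all_reals.

Set Implicit Arguments.
Unset Strict Implicit.
Unset Printing Implicit Defensive.

Import Order.TTheory GRing.Theory Num.Theory.

Local Open Scope classical_set_scope.

(** * Coxeter systems *)

Definition generated_subgroup (W : groupType) (A : set W) : set W :=
  smallest [set H : set W | group_closed (mem H)] A.

Definition has_order (W : groupType) (g : W) (m : nat) : Prop :=
  [/\ (0 < m)%N, (g ^+ m)%g = 1%g &
      forall k : nat, (0 < k < m)%N -> (g ^+ k)%g <> 1%g].

(* Bourbaki's definition: S is finite, generates W, consists of elements of
   order 2, and W is presented by the generators S with the relations
   (s t)^m(s,t) = 1 for all s, t in S whose product has finite order m(s,t).
   The presentation is expressed by its universal property: existence of the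
   extension is the last clause, uniqueness follows from generation. *)
Definition coxeter_system (W : groupType) (S : set W) : Prop :=
  [/\ finite_set S,
      generated_subgroup S = [set: W],
      forall s, S s -> has_order s 2 &
      forall (G : groupType) (f : W -> G),
        (forall s t m, S s -> S t -> has_order (s * t)%g m ->
           ((f s * f t) ^+ m)%g = 1%g) ->
        exists phi : {multiplicative W -> G}, forall s, S s -> phi s = f s].

(* The standard cosets w W_J with J a subset of S (J = S included). The Coxeter
   complex is this set ordered by reverse inclusion: W is the empty simplex and
   the singletons {w} are the chambers. *)
Definition coxeter_complex (W : groupType) (S : set W) : set (set W) :=
  [set X | exists w : W, exists2 J : set W, J `<=` S &
     X = [set (w * v)%g | v in generated_subgroup J]].

(** * Simplicial complexes and buildings *)

(* The empty set is a simplex. Vertices are the v with [fset v] in Delta;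
   elements of V that are not vertices play no role. *)
Definition simplicial_complex (V : choiceType) (Delta : set {fset V}) : Prop :=
  Delta fset0 /\
  forall A B : {fset V}, Delta B -> (A `<=` B)%fset -> Delta A.

Definition subcomplex (V : choiceType) (Sigma Delta : set {fset V}) : Prop :=
  simplicial_complex Sigma /\ Sigma `<=` Delta.

Definition complex_isomorphism (V : choiceType) (Sigma Sigma' : set {fset V})
    (f : V -> V) : Prop :=
  set_inj [set v | Sigma [fset v]%fset] f /\
  [set [fset f v | v in A]%fset | A in Sigma] = Sigma'.

(* A simplicial complex is identified with the poset of its simplices. *)
Definition isomorphic_to_coxeter_complex (V : choiceType)
    (Sigma : set {fset V}) (W : groupType) (S : set W) : Prop :=
  exists2 phi : {fset V} -> set W,
    set_bij Sigma (coxeter_complex S) phi &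
    forall A B, Sigma A -> Sigma B ->
      (A `<=` B)%fset <-> phi B `<=` phi A.

Definition building (V : choiceType) (Delta : set {fset V})
    (W : groupType) (S : set W) : Prop :=
  simplicial_complex Delta /\
  exists apartment : set (set {fset V}),
    [/\ forall Sigma, apartment Sigma -> subcomplex Sigma Delta,
        Delta = \bigcup_(Sigma in apartment) Sigma,
        forall Sigma, apartment Sigma -> isomorphic_to_coxeter_complex Sigma S,
        forall A B, Delta A -> Delta B ->
          exists2 Sigma, apartment Sigma & Sigma A /\ Sigma B &
        forall Sigma Sigma' A B, apartment Sigma -> apartment Sigma' ->
          Sigma A -> Sigma B -> Sigma' A -> Sigma' B ->
          exists2 f : V -> V, complex_isomorphism Sigma Sigma' f &
            forall v, v \in (A `|` B)%fset -> f v = v].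

(** * Metric graphs *)

Record graph (T : Type) := Graph {
  vertex : set T;
  adjacent : T -> T -> Prop }.

Local Open Scope ring_scope.

(* Points of a graph in barycentric coordinates. *)
Definition vertex_point (R : realType) (T : choiceType) (u : T) : T -> R :=
  fun w => (w == u)%:R.

Definition edge_point (R : realType) (T : choiceType) (u v : T) (t : R) :
    T -> R :=
  fun w => (1 - t) * vertex_point R u w + t * vertex_point R v w.

Definition realization (R : realType) (T : choiceType) (G : graph T) :
    set (T -> R) :=
  [set x | (exists2 u, vertex G u & x = vertex_point R u) \/
           (exists u v (t : R), [/\ adjacent G u v, 0 <= t <= 1 &
                              x = edge_point u v t])].
Arguments realization R {T} G.

(* pl_path G x y l: x and y are joined by a piecewise linear path of length l,
   i.e. a finite concatenation of segments, each inside a closed edge, where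
   edges are isometric to [0, 1]. *)
Inductive pl_path (R : realType) (T : choiceType) (G : graph T) :
    (T -> R) -> (T -> R) -> R -> Prop :=
| pl_path_nil x : pl_path G x x 0
| pl_path_cons u v (s t : R) y l :
    adjacent G u v -> 0 <= s <= 1 -> 0 <= t <= 1 ->
    pl_path G (edge_point u v t) y l ->
    pl_path G (edge_point u v s) y (`|s - t| + l).

(* The induced path metric. If no path joins x to y this is inf set0 = 0, so
   for a disconnected graph is_metric (below) fails. *)
Definition path_dist (R : realType) (T : choiceType) (G : graph T)
    (x y : realization R G) : R :=
  inf [set l | pl_path G (val x) (val y) l].
Arguments path_dist R {T} G x y.

(** * Hyperbolic spaces *)

(* Distances are plain functions rather than metricType structures because
   path_dist is a metric only when the graph is connected. *)
Definition is_metric (R : realType) (X : Type) (d : X -> X -> R) : Prop :=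
  [/\ forall x y, 0 <= d x y,
      forall x y, d x y = 0 <-> x = y,
      forall x y, d x y = d y x &
      forall x y z, d x z <= d x y + d y z].

Definition geodesic (R : realType) (X : Type) (d : X -> X -> R) (x y : X)
    (alpha : set X) : Prop :=
  exists c : R -> X,
    [/\ c 0 = x, c (d x y) = y,
        forall s t, 0 <= s <= d x y -> 0 <= t <= d x y ->
          d (c s) (c t) = `|s - t| &
        alpha = [set c t | t in [set t : R | 0 <= t <= d x y]]].

Definition geodesic_space (R : realType) (X : Type) (d : X -> X -> R) : Prop :=
  is_metric d /\ forall x y, exists alpha, geodesic d x y alpha.

Definition delta_hyperbolic (R : realType) (X : Type) (d : X -> X -> R)
    (delta : R) : Prop :=
  forall x y z (alpha beta gamma : set X),
    geodesic d x y alpha -> geodesic d y z beta -> geodesic d z x gamma ->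
    forall P, alpha P -> exists2 Q, (beta `|` gamma) Q & d P Q <= delta.

Definition hyperbolic (R : realType) (X : Type) (d : X -> X -> R) : Prop :=
  geodesic_space d /\ exists delta : R, delta_hyperbolic d delta.

(** * Word hyperbolic groups and dual graphs *)

Definition cayley_graph (W : groupType) (A : set W) : graph W :=
  Graph [set: W]
    (fun g h => g <> h /\
       exists2 a, A a & h = (g * a)%g \/ g = (h * a)%g).

Definition word_hyperbolic (R : realType) (W : groupType) : Prop :=
  exists A : set W,
    [/\ finite_set A, generated_subgroup A = [set: W] &
        hyperbolic (path_dist R (cayley_graph A))].

Definition chamber (V : choiceType) (Delta : set {fset V}) (C : {fset V}) :
    Prop :=
  Delta C /\ forall D, Delta D -> (C `<=` D)%fset -> D = C.

Definition codim1_face (V : choiceType) (F C : {fset V}) : Prop :=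
  (F `<=` C)%fset /\ #|` C| = #|` F|.+1.

Definition dual_graph (V : choiceType) (Delta : set {fset V}) :
    graph {fset V} :=
  Graph (chamber Delta)
    (fun C D => [/\ chamber Delta C, chamber Delta D, C <> D &
       exists F, codim1_face F C /\ codim1_face F D]).

(* Main.v *)
Require Import Defs.
From mathcomp Require Import all_boot all_order all_algebra finmap.
From mathcomp Require Import all_classical all_reals.
From mathcomp Require Import zify lra ring.

(** Hyperbolicity is tested by the following star inequality with a constant K: for
    every geodesic from x to y, every point p on it and every point z,
    d(z, p) + d(x, p) <= d(x, z) + K or d(z, p) + d(y, p) <= d(y, z) + K. Thin
    triangles imply it, since p is near one of the two other sides
    ([thin_triangle_star]); conversely it implies thin triangles
    ([star_thin_triangle]).

    The point of this form is that it passes from apartments to the building by a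
    single retraction. Given chambers x, y, z and a chamber p on a geodesic from x to y,
    take an apartment containing x and y. Apartments are convex ([ap_convex]), so it
    contains p as well. The retraction onto it centred at p fixes x, y and p,
    preserves the distance from p to z, and increases neither the distance from x to z
    nor that from y to z. So the inequality in the apartment, for the image of z,
    implies the inequality for z ([building_star]). The facts about retractions
    follow from the rigidity of isomorphisms of apartments ([iso_rigid]), which rests on
    thinness: a panel lies in exactly two chambers of an apartment.

    The dual graph of an apartment is the Cayley graph of W with respect to S
    ([apartment_gdist]), whose hyperbolicity is known for some finite generating set
    only. The passage to S is the stability of quasi-geodesics, proved for integer
    distances from the four-point condition: a chain of points avoiding a large ball
    centred on a geodesic has exponentially many steps ([far_chain]), which confines
    quasi-geodesics to bounded neighbourhoods of geodesics
    ([quasigeodesic_near_geodesic], [quasi_isometric_star]).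

    Finally, distances in the realization of a graph are related to lengths of
    walks: a path either stays in one edge or goes through vertices
    ([pl_path_length]), so that distances are attained ([path_dist_min]), the
    realization is a geodesic space, and the star inequality for vertices implies it
    for all points ([star_of_vertices]). *)

Set Implicit Arguments.
Unset Strict Implicit.
Unset Printing Implicit Defensive.

Import Order.TTheory GRing.Theory Num.Theory.

Local Open Scope classical_set_scope.

(** * Walks and the combinatorial distance *)

Section Walks.
Variables (T : Type) (G : graph T).

Definition simple_graph : Prop :=
  [/\ forall u v, adjacent G u v -> adjacent G v u,
      forall u v, adjacent G u v -> u <> v &
      forall u v, adjacent G u v -> vertex G u].

Fixpoint walk (n : nat) (u v : T) : Prop :=
  if n is k.+1 then exists2 w, adjacent G u w & walk k w v else u = v.

Definition connected_graph : Prop :=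
  forall u v, vertex G u -> vertex G v -> exists n, walk n u v.

Definition gdist (u v : T) : nat :=
  if pselect (exists n, `[< walk n u v >]) is left ex then ex_minn ex else 0.

Lemma walk_cat m n u v w : walk m u v -> walk n v w -> walk (m + n) u w.
Proof.
elim: m u => [|m IH] u /=; first by move=> ->.
by move=> [x ux xv] vw; exists x => //; apply: IH.
Qed.

Lemma walk_split m n u v :
  walk (m + n) u v -> exists2 w, walk m u w & walk n w v.
Proof.
elim: m u => [|m IH] u /=; first by exists u.
by move=> [x ux /IH[w xw wv]]; exists w => //; exists x.
Qed.

Lemma gdist_le n u v : walk n u v -> (gdist u v <= n)%N.
Proof.
move=> uv; rewrite /gdist; case: pselect => [ex|[]].
  by case: ex_minnP => m _; apply; apply/asboolP.
by exists n; apply/asboolP.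
Qed.

Lemma gdist_walk n u v : walk n u v -> walk (gdist u v) u v.
Proof.
move=> uv; rewrite /gdist; case: pselect => [ex|[]].
  by case: ex_minnP => m /asboolP.
by exists n; apply/asboolP.
Qed.

Lemma gdistxx u : gdist u u = 0.
Proof. by apply/eqP; rewrite -leqn0; apply: gdist_le. Qed.

Hypotheses (Gsimple : simple_graph) (Gconn : connected_graph).

Lemma walk_sym n u v : walk n u v -> walk n v u.
Proof.
have [sym _ _] := Gsimple.
elim: n u => [|n IH] u /=; first by move=> ->.
move=> [w uw /IH wv]; rewrite -/(walk n.+1 v u) -addn1; apply: walk_cat wv _.
by exists u => //; apply: sym.
Qed.

Lemma walk_vertex n u v : walk n u v -> vertex G u -> vertex G v.
Proof.
have [sym _ vtx] := Gsimple.
elim: n u => [|n IH] u /=; first by move=> ->.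
by move=> [w uw /IH wv _]; apply/wv/(vtx _ u)/sym.
Qed.

Lemma gdistP u v : vertex G u -> vertex G v -> walk (gdist u v) u v.
Proof. by move=> uG vG; have [n /gdist_walk] := Gconn uG vG. Qed.

Lemma gdist_eq0 u v : vertex G u -> vertex G v -> gdist u v = 0 -> u = v.
Proof. by move=> uG vG uv; have := gdistP uG vG; rewrite uv. Qed.

Lemma gdistC u v : vertex G u -> vertex G v -> gdist u v = gdist v u.
Proof.
move=> uG vG; apply/eqP; rewrite eqn_leq.
by rewrite !gdist_le //; apply: walk_sym; apply: gdistP.
Qed.

Lemma gdist_triangle u v w : vertex G u -> vertex G v -> vertex G w ->
  (gdist u w <= gdist u v + gdist v w)%N.
Proof.
by move=> uG vG wG; apply: gdist_le; apply: walk_cat; apply: gdistP.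
Qed.

Lemma gdist_adj u v : adjacent G u v -> gdist u v = 1.
Proof.
have [sym irr vtx] := Gsimple => uv.
have := @gdist_le 1 u v; case E: gdist => [|[|n]] // H.
  by have/irr := uv; case; apply: gdist_eq0 E; [exact: vtx uv|exact: vtx (sym _ _ uv)].
by have : (n.+2 <= 1)%N by apply: H; exists v.
Qed.

End Walks.


(** * The metric realization of a graph *)

Local Open Scope ring_scope.

Section EdgePoints.
Variables (R : realType) (T : choiceType).
Implicit Types (u v w : T) (s t : R).

Lemma edge_point_swap u v t : edge_point u v t = edge_point v u (1 - t).
Proof. by apply/funext => w; rewrite /edge_point; ring. Qed.

Lemma edge_point0 u v : edge_point u v 0 = vertex_point R u.
Proof. by apply/funext => w; rewrite /edge_point; ring. Qed.

Lemma edge_point1 u v : edge_point u v 1 = vertex_point R v.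
Proof. by apply/funext => w; rewrite /edge_point; ring. Qed.

Lemma vertex_pointE u : vertex_point R u u = 1.
Proof. by rewrite /vertex_point eqxx. Qed.

Lemma vertex_point_gt0 u v : 0 < vertex_point R u v -> v = u.
Proof. by rewrite /vertex_point; case: eqP => //; rewrite ltxx. Qed.

Lemma edge_pointl u v t : u <> v -> edge_point u v t u = 1 - t.
Proof. by move=> /eqP/negPf uv; rewrite /edge_point /vertex_point eqxx uv /=; ring. Qed.

Lemma edge_pointr u v t : u <> v -> edge_point u v t v = t.
Proof.
by move=> /eqP/negPf uv; rewrite /edge_point /vertex_point eqxx eq_sym uv /=; ring.
Qed.

Lemma edge_point_gt0 u v t w : 0 < edge_point u v t w -> w = u \/ w = v.
Proof.
rewrite /edge_point /vertex_point; case: eqP; first by left.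
case: eqP; first by right.
by move=> _ _; rewrite !mulr0 addr0 ltxx.
Qed.

Lemma edge_point_dist u v s t w :
  `|edge_point u v s w - edge_point u v t w| <= `|s - t|.
Proof.
have -> : edge_point u v s w - edge_point u v t w =
    (s - t) * (vertex_point R v w - vertex_point R u w).
  by rewrite /edge_point; ring.
rewrite normrM ler_piMr //; rewrite /vertex_point.
by do 2 case: eqP => _ /=; rewrite ?subrr ?subr0 ?sub0r ?normrN ?normr0 ?normr1.
Qed.

End EdgePoints.

Section Paths.
Variables (R : realType) (T : choiceType) (G : graph T).
Hypothesis Gsimple : simple_graph G.
Implicit Types (u v w : T) (x y z : T -> R).

Lemma pl_path_ge0 x y l : pl_path G x y l -> 0 <= l.
Proof. by elim=> // *; apply: addr_ge0. Qed.

Lemma pl_path_cat x y z l m :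
  pl_path G x y l -> pl_path G y z m -> pl_path G x z (l + m).
Proof.
move=> xy yz; elim: xy yz => [x'|u v s t y' l' uv s01 t01 _ IH] yz.
  by rewrite add0r.
by rewrite -addrA; apply: pl_path_cons => //; apply: IH.
Qed.

Lemma pl_path_edge u v (s t : R) : adjacent G u v -> 0 <= s <= 1 -> 0 <= t <= 1 ->
  pl_path G (edge_point u v s) (edge_point u v t) `|s - t|.
Proof.
by move=> uv s01 t01; rewrite -[X in pl_path _ _ _ X]addr0; apply: pl_path_cons => //; constructor.
Qed.

Lemma pl_path_sym x y l : pl_path G x y l -> pl_path G y x l.
Proof.
elim=> [x'|u v s t y' l' uv s01 t01 _ IH]; first by constructor.
by rewrite addrC distrC; apply: pl_path_cat IH _; apply: pl_path_edge.
Qed.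

(** This is what makes the distance of distinct points positive. *)
Lemma pl_path_lip x y l w : pl_path G x y l -> `|x w - y w| <= l.
Proof.
elim=> [x'|u v s t y' l' uv s01 t01 _ IH]; first by rewrite subrr normr0.
apply: le_trans (ler_distD (edge_point u v t w) _ _) _.
by apply: lerD => //; apply: edge_point_dist.
Qed.

Lemma walk_pl_path n u v : walk G n u v ->
  pl_path G (vertex_point R u) (vertex_point R v) n%:R.
Proof.
elim: n u => [|n IH] u /=; first by move=> ->; constructor.
move=> [w uw /IH wv]; rewrite -(edge_point0 R u w) -add1n natrD.
have -> : 1%:R = `|0 - 1| :> R by rewrite sub0r normrN normr1.
by apply: pl_path_cons; rewrite ?edge_point1 ?lexx ?ler01.
Qed.

Lemma pl_path_support x v : realization R G x -> 0 < x v ->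
  pl_path G x (vertex_point R v) (1 - x v).
Proof.
have [_ irr _] := Gsimple.
case=> [[u _ ->] /vertex_point_gt0 ->|[u [w [t [uw t01 ->]]]]].
  by rewrite vertex_pointE subrr; constructor.
have [/irr uNw /andP[t0 t1]] := (uw, t01).
case/edge_point_gt0 => ->.
  rewrite edge_pointl // -(edge_point0 R u w).
  have -> : 1 - (1 - t) = `|t - 0| by rewrite subr0 ger0_norm //; ring.
  by apply: pl_path_edge; rewrite ?lexx ?ler01.
rewrite edge_pointr // -(edge_point1 R u w).
have -> : 1 - t = `|t - 1| by rewrite distrC ger0_norm ?subr_ge0.
by apply: pl_path_edge; rewrite ?lexx ?ler01.
Qed.

Lemma support_nonempty x : realization R G x ->
  exists v, 0 < x v /\ vertex G v.
Proof.
have [sym irr vtx] := Gsimple.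
case=> [[u uG ->]|[u [w [t [uw /andP[t0 t1] ->]]]]].
  by exists u; rewrite vertex_pointE.
have uNw := irr _ _ uw; have [t_gt0|t_le0] := ltP 0 t.
  by exists w; rewrite edge_pointr //; split=> //; apply/(vtx _ u)/sym.
by exists u; rewrite edge_pointl //; split; [lra|apply: vtx uw].
Qed.

Lemma support_vertex x v : realization R G x -> 0 < x v -> vertex G v.
Proof.
have [sym irr vtx] := Gsimple.
case=> [[u uG ->] /vertex_point_gt0 -> //|[u [w [t [uw t01 ->]]]]].
by case/edge_point_gt0 => ->; [apply: vtx uw|apply/(vtx _ u)/sym].
Qed.

Lemma support_finite x : realization R G x ->
  exists s : seq T, forall v, 0 < x v -> v \in s.
Proof.
case=> [[u _ ->]|[u [w [t [_ _ ->]]]]].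
  by exists [:: u] => v /vertex_point_gt0 ->; rewrite inE.
by exists [:: u; w] => v /edge_point_gt0 [] ->; rewrite !inE eqxx ?orbT.
Qed.

Definition through_vertices x y (l : R) : Prop :=
  exists v w n, [/\ 0 < x v, 0 < y w, walk G n v w &
                    (1 - x v) + n%:R + (1 - y w) <= l].

Definition in_edge x y (l : R) : Prop :=
  exists u v s t, [/\ adjacent G u v, 0 <= s <= 1 /\ 0 <= t <= 1,
    x = edge_point u v s, y = edge_point u v t & `|s - t| <= l].

(** The far end of the edge, rather than u itself, is the witness when s = 1: the
    walk must start at a vertex where the point has a positive coordinate. *)
Lemma edge_exit u v (s : R) : adjacent G u v -> 0 <= s <= 1 ->
  exists w k, [/\ 0 < edge_point u v s w, walk G k w u &
                  1 - edge_point u v s w + k%:R <= s].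
Proof.
have [sym irr _] := Gsimple => uv /andP[s0 s1]; have uNv := irr _ _ uv.
have [s_lt1|s_ge1] := ltP s 1.
  by exists u, 0%N; rewrite edge_pointl //; split=> //; lra.
exists v, 1%N; rewrite edge_pointr //; split; [lra| |lra].
by exists u => //; apply: sym.
Qed.

Lemma through_cons_aux u v (s t : R) y w n l :
  adjacent G u v -> 0 <= s <= 1 -> 0 <= t <= 1 -> walk G n u w -> 0 < y w ->
  t + n%:R + (1 - y w) <= l ->
  through_vertices (edge_point u v s) y (`|s - t| + l).
Proof.
move=> uv s01 t01 uw yw tl; have [a [k [a0 au ak]]] := edge_exit uv s01.
exists a, w, (k + n)%N; split=> //; first exact: walk_cat au uw.
rewrite natrD; have := ler_norm (s - t); lra.
Qed.

Lemma through_cons u v (s t : R) y l :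
  adjacent G u v -> 0 <= s <= 1 -> 0 <= t <= 1 ->
  through_vertices (edge_point u v t) y l ->
  through_vertices (edge_point u v s) y (`|s - t| + l).
Proof.
have [sym irr _] := Gsimple => uv s01 t01; have uNv := irr _ _ uv.
move=> [a [w [n [a0 yw aw al]]]].
have [E|E] := edge_point_gt0 a0; move: al aw; rewrite {}E {a a0}.
  rewrite edge_pointl // => al aw; apply: (through_cons_aux _ _ _ aw) => //.
  by move: al; lra.
rewrite edge_pointr // => al aw; rewrite edge_point_swap distrC.
have -> : t - s = (1 - s) - (1 - t) by ring.
move: s01 t01 => /andP[s0 s1] /andP[t0 t1].
by apply: (through_cons_aux _ _ _ aw) => //; [exact: sym|lra|lra].
Qed.

(** A vertex may occur as an endpoint of many edges, so that the edge in which a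
    path starting there runs is not determined; counting the vertex itself as the
    exit removes this ambiguity. *)
Lemma in_edge_vertex u y l :
  in_edge (vertex_point R u) y l -> through_vertices (vertex_point R u) y l.
Proof.
have [sym irr _] := Gsimple.
have main u' v' (t : R) : adjacent G u' v' -> 0 <= t <= 1 -> u = u' ->
    y = edge_point u' v' t -> t <= l ->
    through_vertices (vertex_point R u) y l.
  move=> uv t01 -> -> tl; have [w [k [w0 wu wk]]] := edge_exit uv t01.
  exists u', w, k; rewrite vertex_pointE; split=> //; last by lra.
  exact: walk_sym.
move=> [a [b [s [t [ab [/andP[s0 s1] t01] us yt st]]]]].
have aNb := irr _ _ ab.
have us1 : edge_point a b s u = 1 by rewrite -us vertex_pointE.
have : 0 < edge_point a b s u by rewrite us1.
case/edge_point_gt0 => [ua|ub].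
  apply: (main _ _ _ ab t01 ua yt); move: us1; rewrite ua edge_pointl // => us1.
  by have := ler_norm (t - s); rewrite distrC; lra.
have s_eq1 : s = 1 by rewrite -us1 ub edge_pointr.
move: t01 => /andP[t0 t1].
apply: (main b a (1 - t)) => //; [exact: sym|lra|by rewrite yt edge_point_swap|].
by have := ler_norm (s - t); lra.
Qed.

(** An interior point of an edge determines the edge, so a path changes edges only at
    vertices, and a path between vertices is at least as long as a walk. This
    reduces the computation of distances to finitely many lengths. *)
Lemma pl_path_length x y l : pl_path G x y l -> realization R G x ->
  through_vertices x y l \/ in_edge x y l.
Proof.
have [sym irr _] := Gsimple.
elim=> {x y l} [x|u v s t y l uv s01 t01 _ IH] xG.
  case: xG => [[u uG ->]|[u [v [t [uv t01 ->]]]]]; [left|right].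
    by exists u, u, 0%N; rewrite vertex_pointE; split=> //; lra.
  by exists u, v, t, t; rewrite subrr normr0.
have tG : realization R G (edge_point u v t) by right; exists u, v, t.
have [|] := IH tG; first by left; apply: through_cons.
move=> ty; have uNv := irr _ _ uv.
have [t0|tN0] := eqVneq t 0.
  left; apply: through_cons => //.
  by move: ty; rewrite t0 edge_point0; exact: in_edge_vertex.
have [t1|tN1] := eqVneq t 1.
  left; apply: through_cons => //.
  by move: ty; rewrite t1 edge_point1; exact: in_edge_vertex.
(* an interior point of an edge determines this edge up to its orientation *)
right; case: ty => a [b [s' [t' [ab [s'01 t'01] E yt st]]]].
have aNb := irr _ _ ab; move: (t01) => /andP[t0 t1].
have tgt0 : 0 < t by rewrite lt_neqAle eq_sym tN0.
have tlt1 : t < 1 by rewrite lt_neqAle tN1.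
have Eu : edge_point a b s' u = 1 - t by rewrite -E edge_pointl.
have Ev : edge_point a b s' v = t by rewrite -E edge_pointr.
have u0 : 0 < edge_point a b s' u by rewrite Eu; lra.
have v0 : 0 < edge_point a b s' v by rewrite Ev.
case: (edge_point_gt0 u0) (edge_point_gt0 v0) => [ua|ub] [va|vb].
- by case: uNv; rewrite ua va.
- exists u, v, s, t'; split=> //; first by rewrite ua vb.
  have s't : s' = t by move: Ev; rewrite vb edge_pointr.
  by rewrite -s't in E *; apply: le_trans (ler_distD s' _ _) _; rewrite lerD2l.
- exists u, v, s, (1 - t'); split=> //.
  + by move: t'01 => /andP[? ?]; split=> //; lra.
  + by rewrite yt edge_point_swap ub va.
  have s't : s' = 1 - t by move: Eu; rewrite ub edge_pointr.
  apply: le_trans (ler_distD t _ _) _; rewrite lerD2l.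
  have -> : t - (1 - t') = - (s' - t') by rewrite s't; ring.
  by rewrite normrN.
- by case: uNv; rewrite ub vb.
Qed.

End Paths.

(** * The path metric of a connected graph *)

Lemma min_of_candidates (R : realType) (L : set R) (cs : seq R) :
  L !=set0 -> (forall l, L l -> exists c, [/\ c \in cs, L c & c <= l]) ->
  exists2 m, L m & forall l, L l -> m <= l.
Proof.
move=> [l0 Ll0] cand; pose ds := [seq c <- cs | `[< L c >]].
have [c0 [c0cs Lc0 _]] := cand _ Ll0.
have c0ds : c0 \in ds by rewrite mem_filter c0cs andbT; apply/asboolP.
pose m := \big[Num.min/c0]_(c <- ds) c.
have mds : m \in ds.
  rewrite /m big_seq; elim/big_ind: _ => // a b ads bds.
  by rewrite minEle; case: ifP.
exists m; first by move: mds; rewrite mem_filter => /andP[/asboolP].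
move=> l /cand[c [ccs Lc cl]]; apply: bigmin_inf_seq cl => //.
by rewrite mem_filter ccs andbT; apply/asboolP.
Qed.

Section PathMetric.
Variables (R : realType) (T : choiceType) (G : graph T).
Hypotheses (Gsimple : simple_graph G) (Gconn : connected_graph G).
Let X : Type := realization R G.
Let d : X -> X -> R := @path_dist R T G.
Implicit Types (u v w : T) (x y z : X).

Lemma realizationP x : realization R G (val x).
Proof. by apply: set_mem; apply: valP. Qed.

Lemma path_through x y v w n : 0 < val x v -> 0 < val y w -> walk G n v w ->
  pl_path G (val x) (val y) ((1 - val x v) + n%:R + (1 - val y w)).
Proof.
move=> xv yw vw; apply: (@pl_path_cat _ _ _ _ (vertex_point R w)).
  apply: (@pl_path_cat _ _ _ _ (vertex_point R v)); last exact: walk_pl_path.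
  by apply: pl_path_support => //; apply: realizationP.
by apply: pl_path_sym; apply: pl_path_support => //; apply: realizationP.
Qed.

(** By the analysis of path lengths, every path is at least as long as one of
    finitely many paths, which follow shortest walks or stay in one edge. So the
    infimum defining the distance is attained. *)
Lemma path_dist_min x y : pl_path G (val x) (val y) (d x y) /\
  forall l, pl_path G (val x) (val y) l -> d x y <= l.
Proof.
have [_ irr _] := Gsimple.
have [xG yG] := (realizationP x, realizationP y).
pose L := [set l | pl_path G (val x) (val y) l].
have [a [xa aG]] := support_nonempty Gsimple xG.
have [b [yb bG]] := support_nonempty Gsimple yG.
have L0 : L !=set0.
  by eexists; apply: (path_through xa yb (gdistP Gconn aG bG)).
have [sx sxP] := support_finite xG; have [sy syP] := support_finite yG.
pose cs := [seq (1 - val x v) + (gdist G v w)%:R + (1 - val y w) |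
             v <- sx, w <- sy] ++ [seq `|val x v - val y v| | v <- sx].
have [|m Lm mmin] := @min_of_candidates R L cs L0.
  move=> l /(pl_path_length Gsimple)/(_ xG)[].
    move=> [v [w [n [xv yw vw nl]]]].
    exists ((1 - val x v) + (gdist G v w)%:R + (1 - val y w)); split.
    - rewrite mem_cat; apply/orP; left.
      by apply/allpairsP; exists (v, w); split=> //=; [exact: sxP|exact: syP].
    - by apply: path_through => //; apply: gdist_walk vw.
    apply: le_trans nl; rewrite lerD2r lerD2l ler_nat; exact: gdist_le.
  move=> [u [v [s [t [uv [s01 t01] xs yt stl]]]]]; have uNv := irr _ _ uv.
  exists `|s - t|; split=> //; last by rewrite /L /= xs yt; apply: pl_path_edge.
  rewrite mem_cat; apply/orP; right; apply/mapP.
  have [s0|s_le0] := ltP 0 s.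
    exists v; last by rewrite xs yt !edge_pointr.
    by apply: sxP; rewrite xs edge_pointr.
  exists u; last by rewrite xs yt !edge_pointl // -normrN; congr `|_|; ring.
  by apply: sxP; rewrite xs edge_pointl //; lra.
suff -> : d x y = m by [].
apply/eqP; rewrite eq_le; apply/andP; split; last exact: lb_le_inf.
by apply: ge_inf => //; exists m => l /mmin.
Qed.

Lemma path_dist_le x y l : pl_path G (val x) (val y) l -> d x y <= l.
Proof. by have [_] := path_dist_min x y; apply. Qed.

Lemma path_dist_metric : is_metric d.
Proof.
have ge0 x y : 0 <= d x y by apply: pl_path_ge0; apply: (path_dist_min x y).1.
have sym x y : d x y <= d y x.
  by apply/path_dist_le/pl_path_sym; apply: (path_dist_min y x).1.
split=> // [x y|x y|x y z].
- split=> [xy|->]; last first.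
    by apply/eqP; rewrite eq_le ge0 andbT; apply: path_dist_le; constructor.
  apply: val_inj; apply/funext => w; apply/eqP.
  rewrite -subr_eq0 -normr_le0 -xy.
  by apply: pl_path_lip; apply: (path_dist_min x y).1.
- by apply/eqP; rewrite eq_le !sym.
by apply: path_dist_le; apply: pl_path_cat; apply: (path_dist_min _ _).1.
Qed.

(** The bound by t - s on subpaths turns a path of minimal length into a geodesic:
    by the triangle inequality no subpath of it can be shortened. *)
Lemma pl_path_arc (p q : T -> R) l : pl_path G p q l -> realization R G p ->
  exists c : R -> T -> R, [/\ c 0 = p, c l = q,
    forall r, realization R G (c r) &
    forall s t, 0 <= s -> s <= t -> t <= l -> pl_path G (c s) (c t) (t - s)].
Proof.
have [sym _ _] := Gsimple.
elim=> {p q l} [p|u v s t q l uv s01 t01 tq IH] pG.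
  exists (fun=> p); split=> // s t s0 st t0.
  by have -> : t - s = 0 by [lra]; constructor.
have [|c [c0 cl cG cst]] := IH; first by right; exists u, v, t.
have l0 := pl_path_ge0 tq.
(* traverse the edge in the direction of increasing parameter *)
wlog st : u v s t uv s01 t01 c0 {pG tq IH} / s <= t => [wl|].
  have [st|/ltW ts] := leP s t; first exact: wl.
  rewrite edge_point_swap distrC.
  have -> : t - s = (1 - s) - (1 - t) by ring.
  move: s01 t01 => /andP[s0 s1] /andP[t0 t1].
  apply: wl; [exact: sym|lra|lra| |lra].
  by rewrite c0 edge_point_swap.
rewrite distrC ger0_norm ?subr_ge0 //.
move: s01 t01 => /andP[s0 s1] /andP[t0 t1].
exists (fun r => if r < 0 then edge_point u v s
         else if r <= t - s then edge_point u v (s + r) else c (r - (t - s))).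
split=> [| |r|r r' r0 rr' r'l].
- by rewrite ltxx subr_ge0 st addr0.
- rewrite ifF; last by apply/negbTE; rewrite -leNgt; lra.
  case: ifPn => [lt|_]; last by rewrite addrC addKr.
  have l_eq0 : l = 0 by lra.
  by move: cl; rewrite l_eq0 c0 addr0 addrC subrK.
- case: ifPn => [_|r0]; first by right; exists u, v, s; split=> //; rewrite s0.
  case: ifPn => [rt|//]; right; exists u, v, (s + r); split=> //.
  by move: r0; rewrite -leNgt => r0; lra.
have r'0 : 0 <= r' by lra.
rewrite [r < 0]ltNge r0 [r' < 0]ltNge r'0 /=.
have -> : r' - r = `|(s + r) - (s + r')| by rewrite distrC ger0_norm; lra.
case: (leP r' (t - s)) => r't.
  by rewrite (le_trans rr' r't); apply: pl_path_edge => //; lra.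
rewrite distrC ger0_norm; last by lra.
case: ifPn => [rt|]; last first.
  rewrite -ltNge => rt.
  have -> : s + r' - (s + r) = r' - (t - s) - (r - (t - s)) by ring.
  by apply: cst; lra.
have -> : s + r' - (s + r) = `|(s + r) - t| + (r' - (t - s) - 0).
  by rewrite distrC ger0_norm; lra.
by apply: pl_path_cons; rewrite -?c0 //; [lra|lra|apply: cst; lra].
Qed.

Lemma path_dist_geodesic_space : geodesic_space d.
Proof.
split=> [|x y]; first exact: path_dist_metric.
have [ge0 _ sym tri] := path_dist_metric.
have [xy _] := path_dist_min x y.
have [c [c0 cl cG cst]] := pl_path_arc xy (realizationP x).
pose c' r : X := SigSub (mem_set (cG r)).
exists [set c' t | t in [set t : R | 0 <= t <= d x y]], c'.
have c'0 : c' 0 = x by apply: val_inj.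
have c'l : c' (d x y) = y by apply: val_inj.
split=> //.
have le s t : 0 <= s -> s <= t -> t <= d x y -> d (c' s) (c' t) <= t - s.
  by move=> *; apply: path_dist_le; apply: cst.
have eq s t : 0 <= s -> s <= t -> t <= d x y -> d (c' s) (c' t) = t - s.
  move=> s0 st tl; apply/eqP; rewrite eq_le le //=.
  have := le 0 s; have := le t (d x y); rewrite c'0 c'l.
  have := tri x (c' s) y; have := tri (c' s) (c' t) y.
  move=> h1 h2 /(_ _ _ _)h3 h4.
  have {}h3 : d (c' t) y <= d x y - t by apply: h3; lra.
  have {}h4 : d x (c' s) <= s - 0 by apply: h4; lra.
  lra.
move=> s t /andP[s0 sl] /andP[t0 tl]; have [st|/ltW ts] := leP s t.
  by rewrite eq // distrC ger0_norm ?subr_ge0.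
by rewrite sym eq // ger0_norm ?subr_ge0.
Qed.

Lemma vertex_pointP u : vertex G u -> exists x : X, val x = vertex_point R u.
Proof.
move=> uG; have H : realization R G (vertex_point R u) by left; exists u.
by exists (SigSub (mem_set H)).
Qed.

Lemma path_dist_support x v (xv : X) : 0 < val x v ->
  val xv = vertex_point R v -> d x xv <= 1 - val x v.
Proof.
move=> x0 xvE; apply: path_dist_le; rewrite xvE.
by apply: pl_path_support => //; apply: realizationP.
Qed.

Lemma path_dist_vertex_le x y u v : val x = vertex_point R u ->
  val y = vertex_point R v -> vertex G u -> vertex G v ->
  d x y <= (gdist G u v)%:R.
Proof.
move=> xu yv uG vG; apply: path_dist_le; rewrite xu yv.
by apply: walk_pl_path; apply: gdistP.
Qed.

Lemma path_dist_vertex x y u v : val x = vertex_point R u ->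
  val y = vertex_point R v -> vertex G u -> vertex G v ->
  d x y = (gdist G u v)%:R.
Proof.
move=> xu yv uG vG; apply/eqP; rewrite eq_le path_dist_vertex_le //=.
have [xy _] := path_dist_min x y.
have {xy} : through_vertices G (val x) (val y) (d x y).
  have [//|] := pl_path_length Gsimple xy (realizationP x).
  by rewrite xu; apply: in_edge_vertex.
move=> [a [b [n [xa yb ab]]]].
have au : a = u by move: xa; rewrite xu => /vertex_point_gt0.
have bv : b = v by move: yb; rewrite yv => /vertex_point_gt0.
move: (gdist_le ab); rewrite xu yv au bv !vertex_pointE -(ler_nat R).
by lra.
Qed.

(** A shortest path that leaves its first edge exits it at a vertex v and enters its
    last edge at a vertex w; equality in the triangle inequality holds along it. *)
Lemma path_dist_align x y : d x y <= 1 \/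
  exists v w (xv yw : X),
    [/\ vertex G v /\ vertex G w, val xv = vertex_point R v,
        val yw = vertex_point R w, d x xv <= 1 /\ d yw y <= 1 &
        d x y = d x xv + (gdist G v w)%:R + d yw y].
Proof.
have [ge0 _ sym tri] := path_dist_metric.
have [xG yG] := (realizationP x, realizationP y).
have [xy _] := path_dist_min x y.
have [|] := pl_path_length Gsimple xy xG; last first.
  move=> [u [v [s [t [uv [s01 t01] xs yt _]]]]]; left.
  apply: (@le_trans _ _ `|s - t|).
    by apply: path_dist_le; rewrite xs yt; apply: pl_path_edge.
  by rewrite ler_norml; move: s01 t01 => /andP[? ?] /andP[? ?]; lra.
move=> [v [w [n [xv yw vw le]]]]; right; have vwn := gdist_le vw.
have [vG wG] := (support_vertex Gsimple xG xv, support_vertex Gsimple yG yw).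
have [a aE] := vertex_pointP vG; have [b bE] := vertex_pointP wG.
have xa := path_dist_support xv aE; have := path_dist_support yw bE.
rewrite sym => yb; have ab := path_dist_vertex aE bE vG wG.
exists v, w, a, b; split=> //; first by split; lra.
move: vwn; rewrite -(ler_nat R) => vwn.
have := tri x a y; have := tri a b y; lra.
Qed.

End PathMetric.

(** * Thin triangles and the star inequality *)

Section Metric.
Variables (R : realType) (X : Type) (d : X -> X -> R).
Implicit Types (x y z w p q : X) (K delta : R).

(** The Gromov product form of thin triangles, for a point p of a geodesic from x to
    y and an arbitrary point z. It is the form of hyperbolicity suited to maps that
    keep the distances from p and do not increase the others: the left sides
    involve p, and the right sides grow with the distances from z to x and y. *)
Definition star_inequality K : Prop := forall x y z p,
  d x p + d p y = d x y ->
  d z p + d x p <= d x z + K \/ d z p + d y p <= d y z + K.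

Definition four_point K : Prop := forall x y z w,
  d x z + d y w <= d x y + d z w + K \/ d x z + d y w <= d y z + d x w + K.

Hypothesis dmetric : is_metric d.

Lemma geodesic_sum x y alpha p : geodesic d x y alpha -> alpha p ->
  d x p + d p y = d x y.
Proof.
have [ge0 _ _ _] := dmetric.
move=> [c [c0 cl iso ->]] [t /= /andP[t0 tl] <-].
rewrite -{1}c0 -{1}cl iso ?lexx ?ge0 ?t0 // iso ?lexx ?ge0 ?t0 //.
by rewrite sub0r normrN distrC !ger0_norm ?subr_ge0 //; lra.
Qed.

Lemma geodesic_point x y alpha r : geodesic d x y alpha -> 0 <= r <= d x y ->
  exists2 p, alpha p & d x p = r /\ d p y = d x y - r.
Proof.
have [ge0 _ _ _] := dmetric.
move=> [c [c0 cl iso ->]] r01; exists (c r); first by exists r.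
case/andP: (r01) => r0 rl; rewrite -{1}c0 -{1}cl iso ?lexx ?ge0 ?r0 // iso ?lexx ?ge0 ?r0 //.
by rewrite sub0r normrN distrC !ger0_norm ?subr_ge0.
Qed.

(** A point q of another side within delta of p makes the path through p from z
    to an end of that side almost as short as the side itself. *)
Lemma thin_triangle_star delta x y z alpha p :
  geodesic_space d -> delta_hyperbolic d delta ->
  geodesic d x y alpha -> alpha p ->
  d z p + d x p <= d x z + 2 * delta \/ d z p + d y p <= d y z + 2 * delta.
Proof.
have [_ _ sym tri] := dmetric.
move=> [_ geo] thin xy ap.
have [beta yz] := geo y z; have [gamma zx] := geo z x.
have [q [bq|gq] pq] := thin _ _ _ _ _ _ xy yz zx _ ap; [right|left].
  have := geodesic_sum yz bq; have := tri z q p; have := tri y q p.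
  by rewrite (sym z q) (sym q p); lra.
have := geodesic_sum zx gq; have := tri z q p; have := tri x q p.
by rewrite (sym x q) (sym q p) (sym z x); lra.
Qed.

(** Let p divide the side from x to z like the inscribed circle of the triangle
    x, z, w does. Then both alternatives of the star inequality hold for w, and they
    combine with whichever holds for y. *)
Lemma thin_triangle_four_point delta :
  geodesic_space d -> delta_hyperbolic d delta -> four_point (4 * delta).
Proof.
have [ge0 _ sym tri] := dmetric.
move=> geod thin x y z w; have [alpha xz] := geod.2 x z.
pose r := (d x z + d x w - d z w) / 2.
have [|p ap [xp pz]] := @geodesic_point _ _ _ r xz.
  rewrite /r; have := tri x z w; have := tri x w z; have := tri z x w.
  by rewrite (sym z x) (sym w z); lra.
have pw : d w p + d x p <= d x w + 2 * delta /\ d w p + d z p <= d z w + 2 * delta.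
  have := thin_triangle_star w geod thin xz ap.
  by rewrite (sym z p) xp pz /r; lra.
have := thin_triangle_star y geod thin xz ap.
have := tri y p w; have := tri x p z; have [] := pw.
by rewrite (sym p w) (sym p z) (sym z y); lra.
Qed.

(** If p is almost aligned with x and y, compare p with the point q of the
    geodesic at the same distance from x: the star inequality at q, with p as
    the point off the geodesic, bounds the distance from p to q. *)
Lemma star_thin_side K x y p gamma : star_inequality K ->
  geodesic d x y gamma \/ geodesic d y x gamma ->
  d y p + d x p <= d x y + K ->
  exists2 q, gamma q & d p q <= 2 * K.
Proof.
have [ge0 id0 sym tri] := dmetric => star xy near.
have K0 : 0 <= K.
  have xx : d x x = 0 by apply/id0.
  by have := @star x x x x; rewrite !xx; case; lra.
pose r := Num.min (d x p) (d x y).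
have [q gq [xq qy]] : exists2 q, gamma q & d x q = r /\ d q y = d x y - r.
  have r01 : 0 <= r <= d x y by rewrite /r le_min !ge0 ge_min lexx orbT.
  case: xy => xy; first exact: geodesic_point xy r01.
  have [|q gq [yq qx]] := @geodesic_point _ _ _ (d x y - r) xy.
    by rewrite (sym y x); lra.
  by exists q => //; rewrite (sym x q) (sym q y) yq qx (sym y x); split=> //; ring.
exists q => //; have xqy : d x q + d q y = d x y by rewrite xq qy; ring.
have := star _ _ p _ xqy; have := tri p y q.
move: xq qy near; rewrite (sym p y) (sym q y) /r.
by case: (leP (d x p) (d x y)); lra.
Qed.

Lemma star_thin_triangle K : star_inequality K -> delta_hyperbolic d (2 * K).
Proof.
have [_ _ sym _] := dmetric.
move=> star x y z alpha beta gamma xy yz zx p ap.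
have [near|near] := star _ _ z _ (geodesic_sum xy ap).
  have [q gq pq] := star_thin_side star (or_intror zx) near.
  by exists q => //; right.
have [q gq pq] := star_thin_side star (or_introl yz) near.
by exists q => //; left.
Qed.

End Metric.

Section Vertices.
Variables (R : realType) (T : choiceType) (G : graph T).
Hypotheses (Gsimple : simple_graph G) (Gconn : connected_graph G).

Definition vertex_star (K : nat) : Prop := forall u v w p,
  vertex G u -> vertex G v -> vertex G w -> vertex G p ->
  (gdist G u p + gdist G p v = gdist G u v)%N ->
  (gdist G w p + gdist G u p <= gdist G u w + K)%N \/
  (gdist G w p + gdist G v p <= gdist G v w + K)%N.

Lemma near_vertex (x : realization R G) : exists v (xv : realization R G),
  [/\ vertex G v, val xv = vertex_point R v & path_dist R G x xv <= 1].
Proof.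
have xG := realizationP x.
have [v [xv vG]] := support_nonempty Gsimple xG.
have [a aE] := vertex_pointP R vG; exists v, a; split=> //.
have := path_dist_support Gsimple Gconn xv aE; lra.
Qed.

(** A geodesic of the realization passes through vertices near p and near its
    ends, and these are again aligned; so the inequality for vertices passes to all
    points at the cost of a few edge lengths. *)
Lemma star_of_vertices K : vertex_star K ->
  star_inequality (@path_dist R T G) (K%:R + 6).
Proof.
move=> star x y z p xpy.
have [ge0 _ sym tri] := path_dist_metric R Gsimple Gconn.
have K0 : 0 <= K%:R :> R by rewrite ler0n.
have [xp|] := path_dist_align Gsimple Gconn x p.
  by left; have := tri z x p; rewrite (sym z x); lra.
move=> [u [w [a [b [[uG wG] aE bE [xa bp] xp]]]]].
have py := tri p b y; rewrite (sym p b) in py.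
have [by1|] := path_dist_align Gsimple Gconn b y.
  right; have := tri z y p; rewrite (sym z y) (sym y p); lra.
move=> [w' [v [b' [c [[w'G vG] b'E cE [bb' cy] byE]]]]].
have [t [z0 [tG z0E zz0]]] := near_vertex z.
have ab := path_dist_vertex Gsimple Gconn aE bE uG wG.
have bc := path_dist_vertex Gsimple Gconn bE cE wG vG.
have ac := path_dist_vertex Gsimple Gconn aE cE uG vG.
have b'c := path_dist_vertex Gsimple Gconn b'E cE w'G vG.
have az := path_dist_vertex Gsimple Gconn aE z0E uG tG.
have cz := path_dist_vertex Gsimple Gconn cE z0E vG tG.
have zb := path_dist_vertex Gsimple Gconn z0E bE tG wG.
have cb := path_dist_vertex Gsimple Gconn cE bE vG wG.
have xy := tri x p y.
have aligned : (gdist G u w + gdist G w v = gdist G u v)%N.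
  apply/eqP; rewrite eqn_leq (gdist_triangle Gconn) // andbT.
  rewrite -(ler_nat R) natrD -ab -bc -ac.
  have := tri b p y; have := tri x a y; have := tri a c y; have := tri b b' c; lra.
have := star _ _ t _ uG vG tG wG aligned.
have zp1 := tri z z0 p; have zp2 := tri z0 b p.
rewrite -!(ler_nat R) !natrD -ab -az -cz -zb -cb => -[near|near]; [left|right].
  have := tri a x z0; have := tri x z z0; rewrite (sym a x); lra.
have := tri c y z0; have := tri y z z0; have := tri y c p; have := tri c b p.
rewrite (sym y c); lra.
Qed.

End Vertices.

(** * Stability of quasi-geodesics *)

Local Open Scope nat_scope.

Definition nat_metric (T : Type) (d : T -> T -> nat) : Prop :=
  [/\ forall x, d x x = 0, forall x y, d x y = d y x &
      forall x y z, d x z <= d x y + d y z].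

Definition discrete_geodesic (T : Type) (d : T -> T -> nat) (c : nat -> T)
    (n : nat) : Prop :=
  forall i j, i <= j -> j <= n -> d (c i) (c j) = j - i.

Definition discretely_geodesic (T : Type) (d : T -> T -> nat) : Prop :=
  forall x y, exists c, [/\ c 0 = x, c (d x y) = y & discrete_geodesic d c (d x y)].

Definition nat_four_point (T : Type) (d : T -> T -> nat) (K : nat) : Prop :=
  forall x y z w,
  d x z + d y w <= d x y + d z w + K \/ d x z + d y w <= d y z + d x w + K.

Lemma exponential_dominates (a b : nat) :
  exists k0, forall k, k0 <= k -> a + b * k <= 2 ^ k.
Proof.
pose m := a + 2 * b + 1; exists (m + m) => k mk.
have le1 j : j < 2 ^ j by apply: ltn_expl.
have bm : b <= 2 ^ (m + m) by have := le1 (m + m); rewrite /m; lia.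
rewrite -(subnK mk); elim: (k - (m + m)) => [|j IH].
  rewrite add0n expnD; have := le1 m; move: (2 ^ m) => e em.
  have : m.+1 * m.+1 <= e * e by apply: leq_mul.
  rewrite /m; nia.
rewrite addSn expnS; have : 2 ^ (m + m) <= 2 ^ (j + (m + m)).
  by rewrite leq_exp2l // leq_addl.
move: (2 ^ (m + m)) (2 ^ (j + (m + m))) bm IH => A B bA IH AB; rewrite mulnS.
lia.
Qed.

(** The bound k below plays the role of the logarithm of a D + b; exponentials
    dominate affine functions, so D cannot be large. *)
Lemma log_bound (a b e f : nat) : exists D0, forall D,
  (forall k, a * D + b <= 2 ^ k -> D <= e + f * k) -> D <= D0.
Proof.
pose g := e + f + 1.
have [k0 k0P] := exponential_dominates (a * g + b) (a * g).
exists (g * k0.+1) => D DP; rewrite leqNgt; apply/negP => Dlt.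
have g0 : 0 < g by rewrite /g addn1.
pose k := D %/ g.
have kD : g * k <= D by rewrite mulnC leq_trunc_div.
have Dk : D < g * k.+1 by rewrite mulnC ltn_ceil.
have k0k : k0 < k.
  by rewrite -ltnS -(ltn_pmul2l g0); apply: leq_ltn_trans Dk; apply: ltnW.
have := DP k; have := k0P k (ltnW k0k).
have aD : a * D <= a * (g * k.+1) by rewrite leq_mul2l (ltnW Dk) orbT.
move=> H /(_ _); have Hk : a * D + b <= 2 ^ k by move: H aD; lia.
move/(_ Hk); move: kD k0k; rewrite /g; nia.
Qed.

(** Discrete intermediate value principle. *)
Lemma last_step (P : nat -> Prop) n : P 0 ->
  P n \/ exists i, [/\ i < n, P i & ~ P i.+1].
Proof.
move=> P0; elim: n => [|n [Pn|[i [ilt Pi PSi]]]]; first by left.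
  have [PSn|PSn] := pselect (P n.+1); first by left.
  by right; exists n; rewrite ltnSn.
by right; exists i; rewrite ltnW.
Qed.

Section Chains.
Variables (T : Type) (d : T -> T -> nat) (K : nat).
Hypotheses (dP : nat_metric d) (d4 : nat_four_point d K).

(** The steps whose ends have Gromov product based at p at least M / 2; when M is
    large they stay far from p. *)
Definition far_step (p : T) (M : nat) : graph T :=
  Graph [set: T] (fun x y => d x y + M <= d x p + d y p).

(** The four-point condition bounds Gromov products based at p along a chain:
    halving the chain repeatedly costs K for each halving only. *)
Lemma far_chain p M k m x z : 0 < m -> m <= 2 ^ k ->
  walk (far_step p M) m x z -> d x z + M <= d x p + d z p + K * k.
Proof.
elim: k m x z => [|k IH] m x z m0 mk.
  have -> : m = 1 by move: mk; rewrite expn0; lia.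
  by move=> [y /= xy <-]; lia.
have [m1|mgt1] := leqP m 1.
  have -> : m = 1 by lia.
  by move=> [y /= xy <-]; lia.
move=> xz; rewrite expnS in mk.
have xz2 : walk (far_step p M) (m %/ 2 + (m - m %/ 2)) x z.
  by rewrite subnKC //; lia.
have [y xy yz] := walk_split xz2.
have {}xy : d x y + M <= d x p + d y p + K * k by apply: IH xy; lia.
have {}yz : d y z + M <= d y p + d z p + K * k by apply: IH yz; lia.
have [_ sym _] := dP; have := d4 x y z p; rewrite mulnS; lia.
Qed.

End Chains.

Section Morse.
Variables (T : Type) (d e : T -> T -> nat) (K L : nat).
Hypotheses (dP : nat_metric d) (d4 : nat_four_point d K).
Hypotheses (dgeo : discretely_geodesic d).
Hypotheses (eP : nat_metric e) (egeo : discretely_geodesic e).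
Hypotheses (dLe : forall x y, d x y <= L * e x y).
Hypotheses (eLd : forall x y, e x y <= L * d x y).

Lemma geodesic_step c n i : discrete_geodesic e c n -> i < n ->
  d (c i) (c i.+1) <= L.
Proof. by move=> ce lt; apply: leq_trans (dLe _ _) _; rewrite ce // subSnn muln1. Qed.

Lemma geodesic_far_walk c n p M i m : discrete_geodesic e c n -> i + m <= n ->
  (forall j, j <= n -> M + L <= d (c j) p) ->
  walk (far_step d p M) m (c i) (c (i + m)).
Proof.
move=> ce; elim: m i => [|m IH] i imn far; first by rewrite addn0.
exists (c i.+1); last by rewrite -addSnnS; apply: IH; rewrite // addSnnS.
have := geodesic_step ce (_ : i < n); have := far i; have := far i.+1.
rewrite /=; lia.
Qed.

(** Take a d-geodesic point p at maximal distance D from the e-geodesic c. The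
    detour from the d-geodesic to c at distance about 2 D on both sides of p, and
    along c in between, stays at distance about D from p and has O(D) steps; so
    the bound on chains makes D at most logarithmic in D. *)
Lemma geodesic_near_quasigeodesic : exists D0, forall c n p,
  discrete_geodesic e c n -> d (c 0) p + d p (c n) = d (c 0) (c n) ->
  exists2 i, i <= n & d p (c i) <= D0.
Proof.
have [d0 sym tri] := dP.
have between x y r : r <= d x y -> exists2 q, d x q = r & d q y = d x y - r.
  move=> rxy; have [g [g0 gl gd]] := dgeo x y.
  by exists (g r); [rewrite -g0|rewrite -{1}gl]; rewrite gd // subn0.
have [D0 D0P] := log_bound (6 * L) 2 L K.
exists D0 => c n p0 ce p0x.
pose on p := d (c 0) p + d p (c n) = d (c 0) (c n).
pose near p D := exists2 i, i <= n & d p (c i) <= D.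
have [D [Dall [p [onp Dp]]]] : exists D, (forall q, on q -> near q D) /\
    exists p, on p /\ forall i, i <= n -> D <= d p (c i).
  pose P D := forall q, on q -> near q D.
  have exP : exists D, `[< P D >].
    exists (d (c 0) (c n)); apply/asboolP => q onq; exists 0 => //.
    by rewrite /on sym in onq *; lia.
  case: (ex_minnP exP) => D /asboolP PD Dmin; exists D; split=> //.
  have [D_eq0|Dgt0] := posnP D.
    exists (c 0); split=> [|i _]; last by rewrite D_eq0.
    by rewrite /on d0.
  have : ~ P D.-1 by move=> /asboolP/Dmin; lia.
  move=> /existsNP[q /not_implyP[onq farq]]; exists q; split=> // i ilen.
  by rewrite leqNgt; apply/negP => lt; apply: farq; exists i => //; lia.
suff D_D0 : D <= D0.
  by have [i ilen] := Dall p0 p0x; exists i => //; lia.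
apply: D0P => k Dk.
have [DL|LD] := leqP D L; first by lia.
(* a point of the d-geodesic on either side of p, with its companion on c *)
have side x : x = c 0 \/ x = c n -> exists q i, [/\ i <= n, d x q + d q p = d x p,
    d q p <= 2 * D, d q (c i) <= D & d q (c i) + 2 * D <= d q p + d (c i) p].
  move=> xc; have [|far] := leqP (d x p) (2 * D).
    have [i ilen xi] : exists2 i, i <= n & x = c i.
      by case: xc => ->; [exists 0|exists n].
    move=> xp; exists x, i; rewrite -xi d0; split=> //.
    by have := Dp i ilen; rewrite -xi (sym p); lia.
  have [|q xq qp] := between x p (d x p - 2 * D); first by lia.
  have [|i ilen qi] := Dall q.
    move: onp; rewrite /on; have := tri (c 0) q (c n).
    case: xc xq qp => -> xq qp; have := tri q p (c n); have := tri (c 0) p q.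
      by rewrite (sym p q); lia.
    by rewrite (sym p q) (sym q (c n)) (sym p (c n)); lia.
  exists q, i; split=> //; [lia|lia|].
  by have := Dp i ilen; rewrite (sym p); lia.
have [y [i [ilen yx yp2 yi yfar]]] := side (c 0) (or_introl erefl).
have [z [j [jlen zx zp2 zj zfar]]] := side (c n) (or_intror erefl).
have yz : d y p + d p z <= d y z.
  have := tri (c 0) y (c n); have := tri y z (c n); move: onp.
  by rewrite /on (sym z (c n)) (sym p z) (sym p (c n)); lia.
wlog ij : y z i j ilen jlen yp2 zp2 yi zj yfar zfar yz {yx zx} / i <= j.
  move=> wl; have [ij|/ltnW ji] := leqP i j; first exact: (wl y z i j).
  by apply: (wl z y j i) => //; rewrite (sym z p) (sym p y) (sym z y); lia.
have far m : m <= n -> D - L + L <= d (c m) p.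
  by move=> /Dp; rewrite (sym p); lia.
have ji : j - i <= 6 * L * D.
  apply: leq_trans (_ : L * d (c i) (c j) <= _).
    by rewrite -(ce i j ij jlen).
  have : d (c i) (c j) <= 6 * D.
    have := tri (c i) y (c j); have := tri y p (c j); have := tri p z (c j).
    by rewrite (sym (c i) y) (sym p z); lia.
  nia.
have w : walk (far_step d p (D - L)) (1 + (j - i) + 1) y z.
  apply: walk_cat (_ : walk _ 1 (c j) z); last first.
    by exists z => //=; rewrite (sym (c j) z); lia.
  apply: walk_cat (_ : walk _ 1 y (c i)) _; first by exists (c i) => //=; lia.
  by rewrite -{2}(subnKC ij); apply: (geodesic_far_walk ce); rewrite ?subnKC.
have := far_chain dP d4 _ _ w.
rewrite (sym z p) => /(_ k); lia.
Qed.

(** Along a d-geodesic, points near the part of c before c i are followed by points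
    near the part after c i. Where the change occurs the two parts of c come close,
    and c i lies between them. *)
Lemma quasigeodesic_near_geodesic : exists H, forall c n i,
  discrete_geodesic e c n -> i <= n ->
  d (c 0) (c i) + d (c i) (c n) <= d (c 0) (c n) + H.
Proof.
have [d0 sym tri] := dP.
have [D0 nearP] := geodesic_near_quasigeodesic.
exists (2 * (D0 + L * (L * (2 * D0 + 1)))) => c n i ce ilen.
have [g [g0 gl gd]] := dgeo (c 0) (c n); set m := d (c 0) (c n) in gl gd *.
have gx t : t <= m -> d (c 0) (g t) = t by move=> tm; rewrite -g0 gd // subn0.
have gy t : t <= m -> d (g t) (c n) = m - t by move=> tm; rewrite -{1}gl gd.
suff [t [j [tm jlen gj ij]]] : exists t j, [/\ t <= m, j <= n,
    d (g t) (c j) <= D0 & d (c j) (c i) <= L * (L * (2 * D0 + 1))].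
  have := tri (c 0) (g t) (c i); have := tri (c i) (g t) (c n).
  have := tri (g t) (c j) (c i); rewrite gx // gy // (sym (c i) (g t)); lia.
have close j j' : j <= i -> i <= j' -> j' <= n ->
    d (c j) (c j') <= 2 * D0 + 1 -> d (c j) (c i) <= L * (L * (2 * D0 + 1)).
  move=> ji ij' j'n jj'; apply: leq_trans (dLe _ _) _.
  rewrite leq_mul2l; apply/orP; right.
  rewrite ce //; apply: leq_trans (_ : e (c j) (c j') <= _).
    by rewrite ce //; [exact: leq_sub2r|exact: leq_trans ij'].
  by apply: leq_trans (eLd _ _) _; rewrite leq_mul2l jj' orbT.
pose P t := exists2 j, j <= i & d (g t) (c j) <= D0.
have [|[j ji gj]|[t [tm [j ji gj] PSt]]] := @last_step P m.
- by exists 0 => //; rewrite g0 d0.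
- exists m, j; split=> //; first exact: leq_trans ji ilen.
  by apply: (close j n) => //; rewrite sym -gl; lia.
have [|j' j'n gj'] := nearP c n (g t.+1) ce; first by rewrite gx // gy // subnKC.
have ij' : i <= j'.
  by rewrite leqNgt; apply/negP => lt; apply: PSt; exists j' => //; apply: ltnW.
exists t, j; split=> //; [exact: ltnW|exact: leq_trans ji ilen|].
apply: (close j j') => //; have := tri (c j) (g t) (c j').
have := tri (g t) (g t.+1) (c j'); rewrite gd // subSnn (sym (c j) (g t)); lia.
Qed.

(** This makes it possible to apply the stability of quasi-geodesics at a prescribed
    point p. *)
Lemma concat_geodesic u p v : e u p + e p v = e u v -> exists c,
  [/\ c 0 = u, c (e u p) = p, c (e u v) = v & discrete_geodesic e c (e u v)].
Proof.
have [e0 sym tri] := eP => upv.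
have [c [c0 cl cd]] := egeo u p; have [c' [c'0 c'l c'd]] := egeo p v.
pose g i := if i <= e u p then c i else c' (i - e u p).
have gE i : i <= e p v -> g (e u p + i) = c' i.
  move=> _; rewrite /g; case: leqP => [|_]; last by rewrite addKn.
  case: i => [|i] iup; last by lia.
  by rewrite addn0 cl c'0.
exists g; split.
- by rewrite /g.
- by rewrite /g leqnn.
- by rewrite -upv gE.
move=> i j ij jl; have [jp|pj] := leqP j (e u p).
  by rewrite /g jp (leq_trans ij jp) cd.
have [ip|pi] := leqP i (e u p); last first.
  rewrite -(subnKC (ltnW pi)) -(subnKC (ltnW pj)) !gE; try lia.
  by rewrite c'd; lia.
rewrite -(subnKC (ltnW pj)) gE; last by lia.
rewrite /g ip; set k := j - e u p.
have kv : k <= e p v by rewrite /k; lia.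
have := cd 0 i; have := cd i (e u p); have := c'd 0 k; have := c'd k (e p v).
rewrite c0 cl c'0 c'l; have := tri u (c i) v; have := tri (c i) (c' k) v.
have := tri (c i) p (c' k) => h1 h2 h3 /(_ kv (leqnn _)) h4 /(_ isT kv) h5.
by move=> /(_ ip (leqnn _)) h6 /(_ isT ip) h7; rewrite /k in h1 h2 h3 h4 h5 *; lia.
Qed.

(** Compare p with a point of c at about the same distance from the start: both
    are almost aligned with the ends, so the four-point condition forces them to
    be close. *)
Lemma aligned_near_quasigeodesic E : exists H, forall c n p,
  discrete_geodesic e c n -> d (c 0) p + d p (c n) <= d (c 0) (c n) + E ->
  exists2 i, i <= n & d p (c i) <= H.
Proof.
have [d0 sym tri] := dP.
have [H HP] := quasigeodesic_near_geodesic.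
exists (L + H + K + E) => c n p ce pE.
pose P i := d (c 0) (c i) <= d (c 0) p.
have [|Pn|[i [ilt Pi]]] := @last_step P n; first by rewrite /P d0.
  exists n => //; rewrite /P in Pn; lia.
rewrite /P => /negP; rewrite -ltnNge => PSi; exists i; first exact: ltnW.
have := d4 (c 0) p (c n) (c i); have := HP c n i ce (ltnW ilt).
have := tri (c 0) (c i) (c i.+1); have := geodesic_step ce ilt.
rewrite (sym (c n) (c i)) /P in Pi *; lia.
Qed.

(** An e-geodesic is a quasi-geodesic for d, so its points p are almost aligned for d.
    The four-point condition makes p almost aligned for d with w and one of the
    ends, hence near an e-geodesic between these two. *)
Lemma quasi_isometric_star : exists H, forall u v w p,
  e u p + e p v = e u v ->
  e w p + e u p <= e u w + H \/ e w p + e v p <= e v w + H.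
Proof.
have [d0 dsym dtri] := dP; have [e0 esym etri] := eP.
have [H HP] := quasigeodesic_near_geodesic.
have [H' H'P] := aligned_near_quasigeodesic (H + K).
have side x w p : d x p + d p w <= d x w + (H + K) ->
    e w p + e x p <= e x w + 2 * (L * H').
  move=> xpw; have [c [c0 cl ce]] := egeo x w.
  have [|i ilen pi] := H'P c _ p ce; first by rewrite c0 cl.
  have pe : e p (c i) <= L * H'.
    by apply: leq_trans (eLd _ _) _; rewrite leq_mul2l pi orbT.
  have := ce 0 i isT ilen; have := ce i _ ilen (leqnn _); rewrite c0 cl subn0.
  have := etri w (c i) p; have := etri x (c i) p.
  by rewrite (esym (c i) p) (esym w (c i)); lia.
exists (2 * (L * H')) => u v w p upv.
have [c [c0 cp cl ce]] := concat_geodesic upv.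
have := HP c _ (e u p) ce; rewrite c0 cp cl -upv leq_addr => /(_ isT) upv'.
have [near|near] := d4 u w v p; [left|right]; apply: side.
  by rewrite (dsym v p) in near; rewrite (dsym p w); lia.
by rewrite (dsym v p) (dsym p w) (dsym v w); lia.
Qed.

End Morse.

(** * Word metrics *)

Lemma walk_function (T : Type) (G : graph T) n u v : walk G n u v ->
  exists c : nat -> T, [/\ c 0 = u, c n = v &
    forall i, i < n -> adjacent G (c i) (c i.+1)].
Proof.
elim: n u => [|n IH] u /=; first by move=> ->; exists (fun=> v).
move=> [w uw /IH[c [c0 cn cadj]]].
exists (fun i => if i is j.+1 then c j else u); split=> // -[|i] /=.
  by rewrite c0.
exact: cadj.
Qed.

Lemma gdist_discretely_geodesic (T : Type) (G : graph T) :
  simple_graph G -> connected_graph G -> (forall u, vertex G u) ->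
  nat_metric (gdist G) /\ discretely_geodesic (gdist G).
Proof.
move=> Gs Gc Gv; have tri x y z : gdist G x z <= gdist G x y + gdist G y z.
  exact: gdist_triangle.
split; first by split=> [x|x y|//]; [exact: gdistxx|exact: gdistC].
move=> x y; have [c [c0 cl cadj]] := walk_function (gdistP Gc (Gv x) (Gv y)).
have le i k : i + k <= gdist G x y -> gdist G (c i) (c (i + k)) <= k.
  elim: k => [|k IH] ik; first by rewrite addn0 gdistxx.
  apply: leq_trans (tri _ (c (i + k)) _) _.
  rewrite addnS in ik *; rewrite (gdist_adj Gs Gc (cadj _ ik)).
  by rewrite addn1 ltnS IH //; apply: ltnW.
exists c; split=> // i j ij jl; apply/eqP; rewrite eqn_leq.
have := le i (j - i); rewrite subnKC // => -> //=.
have := tri x (c i) y; have := tri (c i) (c j) y.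
have := le 0 i; have := le j (gdist G x y - j).
rewrite subnKC // add0n c0 cl => /(_ (leqnn _)) h1 /(_ (leq_trans ij jl)).
lia.
Qed.

Section Cayley.
Variables (W : groupType) (A : set W).

Lemma cayley_simple : simple_graph (cayley_graph A).
Proof.
split=> [u v [uv [a Aa auv]]|u v []//|//].
split; first by move=> vu; apply: uv.
by exists a => //; case: auv; [right|left].
Qed.

Lemma cayley_walk_translate g n u v : walk (cayley_graph A) n u v ->
  walk (cayley_graph A) n (g * u)%g (g * v)%g.
Proof.
elim: n u => [|n IH] u /=; first by move=> ->.
move=> [w [uw [a Aa auw]] /IH wv]; exists (g * w)%g => //; split.
  by move/mulgI.
by exists a => //; case: auw => ->; [left|right]; rewrite mulgA.
Qed.

Hypothesis Agen : generated_subgroup A = [set: W].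

Lemma cayley_connected : connected_graph (cayley_graph A).
Proof.
pose H : set W := [set w | exists n, walk (cayley_graph A) n 1%g w].
suff HT : H = [set: W].
  move=> u v _ _; have : H (u^-1 * v)%g by rewrite HT.
  by move=> [n /(cayley_walk_translate u)]; rewrite mulg1 mulVKg; exists n.
apply/seteqP; split=> // w _.
have : generated_subgroup A w by rewrite Agen.
apply; split=> [|a Aa /=]; last first.
  have [->|a1] := pselect (a = 1%g); first by exists 0.
  exists 1, a => //; split; first by move=> a1'; apply: a1.
  by exists a => //; left; rewrite mul1g.
split; first by apply/mem_set; exists 0.
move=> u v /set_mem[m um] /set_mem[n vn]; apply/mem_set; exists (m + n).
apply: walk_cat um _; apply: walk_sym; first exact: cayley_simple.
by have := cayley_walk_translate (u / v)%g vn; rewrite mulg1 divgK.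
Qed.

End Cayley.

Lemma finite_set_bounded (T : choiceType) (A : set T) (f : T -> nat) :
  finite_set A -> exists L, forall a, A a -> f a <= L.
Proof.
move=> /finite_seqP[s ->]; exists (\max_(a <- s) f a) => a /= sa.
exact: leq_bigmax_seq.
Qed.

Lemma word_metric_lipschitz (W : groupType) (A B : set W) :
  generated_subgroup A = [set: W] -> generated_subgroup B = [set: W] ->
  finite_set B -> exists L, forall x y,
  gdist (cayley_graph A) x y <= L * gdist (cayley_graph B) x y.
Proof.
move=> Agen Bgen Bfin.
have [L LP] := finite_set_bounded (gdist (cayley_graph A) 1%g) Bfin.
have [As Ac] := (cayley_simple A, cayley_connected Agen).
exists L => x y; move: (gdistP (cayley_connected Bgen) (I : vertex (cayley_graph B) x)
  (I : vertex (cayley_graph B) y)).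
move: (gdist (cayley_graph B) x y) => n; elim: n x => [|n IH] x /=.
  by move=> ->; rewrite gdistxx.
move=> [w [_ [b Bb xbw]] /IH wy].
apply: leq_trans (gdist_triangle Ac I (I : vertex (cayley_graph A) w) I) _.
rewrite mulnS; apply: leq_add wy; apply: leq_trans (LP _ Bb).
have step g : gdist (cayley_graph A) g (g * b)%g <= gdist (cayley_graph A) 1%g b.
  have := cayley_walk_translate g (@gdistP _ _ Ac 1%g b I I).
  by rewrite mulg1; apply: gdist_le.
by case: xbw => -> //; rewrite (gdistC As Ac I I).
Qed.

(** Word hyperbolicity speaks of some generating set A; the word metrics for A and S
    are bilipschitz, and the stability of quasi-geodesics carries thin triangles
    from the one to the other. *)
Lemma word_hyperbolic_star (R : realType) (W : groupType) (S : set W) :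
  word_hyperbolic R W -> finite_set S -> generated_subgroup S = [set: W] ->
  exists H, vertex_star (cayley_graph S) H.
Proof.
move=> [A [Afin Agen [geo [delta thin]]]] Sfin Sgen.
have [As Ac] := (cayley_simple A, cayley_connected Agen).
have [Ss Sc] := (cayley_simple S, cayley_connected Sgen).
have [dP dgeo] := gdist_discretely_geodesic As Ac (fun=> I).
have [eP egeo] := gdist_discretely_geodesic Ss Sc (fun=> I).
have [L1 dLe] := word_metric_lipschitz Agen Sgen Sfin.
have [L2 eLd] := word_metric_lipschitz Sgen Agen Afin.
have [K deltaK] : exists K, (4 * delta <= K%:R :> R)%R.
  exists (Num.bound `|4 * delta|%R); apply: le_trans (ler_norm _) _.
  by apply/ltW/archi_boundP.
have d4 : nat_four_point (gdist (cayley_graph A)) K.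
  have rep u : exists x : realization R (cayley_graph A), val x = vertex_point R u.
    exact: vertex_pointP.
  move=> u v w z; have [[a aE] [b bE]] := (rep u, rep v).
  have [[c cE] [x xE]] := (rep w, rep z).
  have := thin_triangle_four_point (path_dist_metric R As Ac) geo thin a b c x.
  rewrite (path_dist_vertex As Ac aE bE I I) (path_dist_vertex As Ac cE xE I I).
  rewrite (path_dist_vertex As Ac aE cE I I) (path_dist_vertex As Ac bE xE I I).
  rewrite (path_dist_vertex As Ac bE cE I I) (path_dist_vertex As Ac aE xE I I).
  by move=> -[le|le]; [left|right]; rewrite -(ler_nat R) !natrD; lra.
have dLe' x y : gdist (cayley_graph A) x y <= (L1 + L2) * gdist (cayley_graph S) x y.
  by apply: leq_trans (dLe x y) _; rewrite leq_mul2r leq_addr orbT.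
have eLd' x y : gdist (cayley_graph S) x y <= (L1 + L2) * gdist (cayley_graph A) x y.
  by apply: leq_trans (eLd x y) _; rewrite leq_mul2r leq_addl orbT.
have [H HP] := quasi_isometric_star dP d4 dgeo eP egeo dLe' eLd'.
by exists H => u v w p _ _ _ _; apply: HP.
Qed.

(** * Coxeter complexes *)

Section SpecialCosets.
Variables (W : groupType) (S : set W).
Implicit Types (w s : W) (J X : set W).

Lemma sub_generated J s : J s -> generated_subgroup J s.
Proof. exact: sub_gen_smallest. Qed.

Lemma generated_closed J : group_closed (mem (generated_subgroup J)).
Proof.
split=> [|u v /set_mem uJ /set_mem vJ]; apply/mem_set.
  by move=> H [[/set_mem]].
move=> H [Hgrp JH]; have [_ Hdiv] := Hgrp.
by apply: set_mem; apply: Hdiv; apply: mem_set; [apply: uJ|apply: vJ].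
Qed.

Lemma generated1 J : generated_subgroup J 1%g.
Proof. by apply: set_mem; apply: (generated_closed J).1. Qed.

Lemma generatedM J u v : generated_subgroup J u -> generated_subgroup J v ->
  generated_subgroup J (u * v)%g.
Proof.
move=> uJ vJ; apply: set_mem.
by apply: (group_closedM (generated_closed J)); apply: mem_set.
Qed.

Lemma generated_set0 : generated_subgroup set0 = [set 1%g : W].
Proof.
apply/seteqP; split=> [|_ ->]; last exact: generated1.
apply: smallest_sub => //; split; first exact/mem_set.
by move=> u v /set_mem -> /set_mem ->; apply/mem_set; rewrite /= divg1.
Qed.

Lemma involution s : has_order s 2 -> (s * s = 1)%g /\ s <> 1%g.
Proof. by move=> [_ ss s1]; split; [rewrite -expg2|apply: (s1 1)]. Qed.

Lemma generated_involution s : has_order s 2 ->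
  generated_subgroup [set s] = [set 1%g; s].
Proof.
move=> /involution[ss _].
have sV : (s^-1 = s)%g by rewrite -[LHS]mulg1 -ss mulKg.
apply/seteqP; split=> [|_ [->|->]]; last 2 first.
- exact: generated1.
- exact: sub_generated.
apply: smallest_sub => [|_ ->]; last by right.
split; first by apply/mem_set; left.
move=> u v /set_mem[] -> /set_mem[] ->; apply/mem_set => /=;
  rewrite ?divg1 ?div1g ?sV ?ss; by [left|right].
Qed.

Lemma coxeter_complex_singleton w : coxeter_complex S [set w].
Proof.
exists w, set0 => //; rewrite generated_set0.
by apply/seteqP; split=> [_ ->|_ [_ -> <-]]; [exists 1%g|]; rewrite ?mulg1.
Qed.

Hypothesis S2 : forall s, S s -> has_order s 2.

Lemma coxeter_complex_pair w s : S s -> coxeter_complex S [set w; (w * s)%g].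
Proof.
move=> Ss; exists w, [set s]; first by move=> _ ->.
rewrite generated_involution; last exact: S2.
apply/seteqP; split=> [_ [->|->]|_ [_ [->|->] <-]].
- by exists 1%g; [left|rewrite mulg1].
- by exists s; [right|].
- by left; rewrite mulg1.
- by right.
Qed.

Lemma coxeter_complex_nonempty X : coxeter_complex S X -> X !=set0.
Proof. by move=> [w [J _ ->]]; exists (w * 1)%g, 1%g; first exact: generated1. Qed.

(** The cosets with two elements are minimal among the special cosets that
    are not singletons; this is why they correspond to panels. *)
Lemma coxeter_complex_contains_pair X w : coxeter_complex S X -> X w ->
  X <> [set w] -> exists2 s, S s & [set w; (w * s)%g] `<=` X.
Proof.
move=> [w' [J JS ->]] [v Jv vw] XNw.
have [J0|/set0P[s Js]] := eqVneq J set0.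
  case: XNw; move: Jv vw; rewrite J0 generated_set0 => -> <-.
  by apply/seteqP; split=> [_ [_ -> <-]|_ ->] //; exists 1%g.
exists s; first exact: JS.
move=> _ [->|->]; first by exists v.
by exists (v * s)%g; [apply: generatedM => //; apply: sub_generated|rewrite -vw mulgA].
Qed.

End SpecialCosets.

Section Chambers.
Variables (V : choiceType).
Implicit Types (Sigma Delta : set {fset V}) (A B C D F : {fset V}).

Lemma dual_graph_simple Delta : simple_graph (dual_graph Delta).
Proof.
split=> [C D [Cc Dc CD [F [FC FD]]]|C D []//|C D []//].
by split=> //; [apply/nesym|exists F].
Qed.

Lemma fsubset_eq_card A B : (A `<=` B)%fset -> #|` A| = #|` B| -> A = B.
Proof. by move=> AB cAB; apply/eqP; rewrite eqEfcard AB cAB leqnn. Qed.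

Lemma codim1_neq F C : codim1_face F C -> F <> C.
Proof. by move=> [_ cF] FC; move: cF; rewrite FC; lia. Qed.

End Chambers.

Section Apartment.
Variables (W : groupType) (S : set W) (V : choiceType) (Sigma : set {fset V}).
Hypothesis Sgen : generated_subgroup S = [set: W].
Hypothesis S2 : forall s, S s -> has_order s 2.
Hypothesis Sigma_cplx : simplicial_complex Sigma.
(** The chambers of Sigma are the simplices that phi maps to singletons [set w], and w
    serves as the label of such a chamber. *)
Variable phi : {fset V} -> set W.
Hypothesis phi_bij : set_bij Sigma (coxeter_complex S) phi.
Hypothesis phi_rev :
  forall A B, Sigma A -> Sigma B -> (A `<=` B)%fset <-> phi B `<=` phi A.
Implicit Types (A B C D F : {fset V}) (w s : W).

Lemma face_simplex A B : Sigma B -> (A `<=` B)%fset -> Sigma A.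
Proof. exact: Sigma_cplx.2. Qed.

Lemma phi_inj A B : Sigma A -> Sigma B -> phi A = phi B -> A = B.
Proof.
by have [_ inj _] := phi_bij => SA SB; apply: inj; apply: mem_set.
Qed.

Lemma phi_surj X : coxeter_complex S X -> exists2 A, Sigma A & phi A = X.
Proof. by have [_ _ surj] := phi_bij => /surj. Qed.

Lemma phi_coxeter A : Sigma A -> coxeter_complex S (phi A).
Proof. by have [fn _ _] := phi_bij => /fn. Qed.

Lemma chamber_of_label w : exists C, Sigma C /\ phi C = [set w].
Proof. by have [C SC Cw] := phi_surj (coxeter_complex_singleton S w); exists C. Qed.

Lemma label_chamber C w : Sigma C -> phi C = [set w] -> chamber Sigma C.
Proof.
move=> SC Cw; split=> // D SD /(phi_rev SC SD); rewrite Cw => Dw.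
apply: phi_inj => //; rewrite Cw; apply/seteqP; split=> // _ ->.
have [v Dv] := coxeter_complex_nonempty (phi_coxeter SD).
by have <- : v = w by apply: Dw.
Qed.

Lemma simplex_in_chamber A : Sigma A ->
  exists C, chamber Sigma C /\ (A `<=` C)%fset.
Proof.
move=> SA; have [w Aw] := coxeter_complex_nonempty (phi_coxeter SA).
have [C [SC Cw]] := chamber_of_label w; exists C; split.
  exact: label_chamber Cw.
by apply/phi_rev => //; rewrite Cw => _ ->.
Qed.

Lemma chamber_label C : chamber Sigma C -> exists w, phi C = [set w].
Proof.
move=> [SC Cmax]; have [w Cw] := coxeter_complex_nonempty (phi_coxeter SC).
have [D [SD Dw]] := chamber_of_label w; exists w; rewrite -Dw; congr phi.
by apply/esym/Cmax => //; apply/phi_rev => //; rewrite Dw => _ ->.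
Qed.

Lemma pair_neq w s : S s -> [set w; (w * s)%g] <> [set w].
Proof.
move=> /S2/involution[_ s1] ww; apply: s1; apply: (mulgI w); rewrite mulg1.
by have : [set w; (w * s)%g] (w * s)%g by [right]; rewrite ww.
Qed.

(** Since phi reverses inclusions, the codimension of a face is read off from the
    position of its coset: nothing lies strictly between the singleton of w and
    the pair of w and w s. *)
Lemma panel_label F C w : Sigma C -> phi C = [set w] -> codim1_face F C ->
  exists2 s, S s & phi F = [set w; (w * s)%g].
Proof.
move=> SC Cw FC; have [FsubC cardC] := FC.
have SF := face_simplex SC FsubC.
have Fw : phi F w by move/(phi_rev SF SC): FsubC; apply; rewrite Cw.
have FNw : phi F <> [set w].
  by rewrite -Cw => /(phi_inj SF SC); apply: codim1_neq.
have [s Ss sF] := coxeter_complex_contains_pair (phi_coxeter SF) Fw FNw.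
exists s => //; have [G SG Gws] := phi_surj (coxeter_complex_pair S2 w Ss).
rewrite -Gws; congr phi.
have FG : (F `<=` G)%fset by apply/phi_rev => //; rewrite Gws.
have GC : (G `<=` C)%fset by apply/phi_rev => //; rewrite Gws Cw => _ ->; left.
apply: fsubset_eq_card => //; apply/eqP; rewrite eqn_leq fsubset_leq_card //=.
rewrite -ltnS -cardC; apply: fproper_ltn_card; rewrite fproperEneq GC andbT.
by apply/eqP => GC'; apply: (@pair_neq w s Ss); rewrite -Gws GC' Cw.
Qed.

Lemma label_panel C w s : Sigma C -> phi C = [set w] -> S s ->
  exists2 F, codim1_face F C & phi F = [set w; (w * s)%g].
Proof.
move=> SC Cw Ss; have [F SF Fws] := phi_surj (coxeter_complex_pair S2 w Ss).
exists F => //; have FC : (F `<=` C)%fset.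
  by apply/phi_rev => //; rewrite Fws Cw => _ ->; left.
split=> //; have FNC : F != C.
  by apply/eqP => FC'; apply: (@pair_neq w s Ss); rewrite -Fws FC' Cw.
have /fsubsetPn[x xC xF] : ~~ (C `<=` F)%fset.
  by apply/negP => CF; move: FNC; rewrite eqEfsubset FC CF.
(* a face between F and C, whose coset must be one of the two extremes *)
pose G := (x |` F)%fset.
have GC : (G `<=` C)%fset by rewrite fsubUset FC fsub1set xC.
have SG := face_simplex SC GC.
have FG : (F `<=` G)%fset by rewrite fsubsetUr.
have cG : #|` G| = #|` F|.+1 by rewrite cardfsU1 xF.
suff -> : C = G by [].
have [GFsub CGsub] : phi G `<=` phi F /\ phi C `<=` phi G.
  by split; apply/phi_rev.
have [Gws|Gws] := pselect (phi G (w * s)%g).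
  suff GF : G = F by move: xF; rewrite -GF !inE eqxx.
  apply: phi_inj => //; apply/seteqP; split=> // v; rewrite Fws => -[->|-> //].
  by apply: CGsub; rewrite Cw.
apply: phi_inj => //; apply/seteqP; split=> // v Gv.
by have := GFsub _ Gv; rewrite Fws Cw => -[//|vws]; case: Gws; rewrite -vws.
Qed.

(** Thinness: a panel lies in exactly two chambers. *)
Lemma thin_exists F C : chamber Sigma C -> codim1_face F C ->
  exists D, [/\ chamber Sigma D, D <> C & codim1_face F D].
Proof.
move=> Cc FC; have [SC _] := Cc; have [w Cw] := chamber_label Cc.
have [s Ss Fws] := panel_label SC Cw FC.
have [D [SD Dws]] := chamber_of_label (w * s)%g.
have [G GD Gws] := label_panel SD Dws Ss.
have [ss s1] := involution (S2 Ss).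
exists D; split; first exact: label_chamber Dws.
  move=> DC; apply: s1; apply: (mulgI w); rewrite mulg1.
  by have : phi D (w * s)%g by [rewrite Dws]; rewrite DC Cw.
suff -> : F = G by [].
apply: phi_inj; [exact: face_simplex SC FC.1|exact: face_simplex SD GD.1|].
by rewrite Fws Gws -mulgA ss mulg1 setUC.
Qed.

Lemma thin_unique F C D D' : chamber Sigma C -> chamber Sigma D ->
  chamber Sigma D' -> codim1_face F C -> (F `<=` D)%fset -> (F `<=` D')%fset ->
  D <> C -> D' <> C -> D = D'.
Proof.
move=> Cc Dc D'c FC FD FD' DC D'C; have [SC _] := Cc.
have [w Cw] := chamber_label Cc.
have [s Ss Fws] := panel_label SC Cw FC.
have lbl E : chamber Sigma E -> (F `<=` E)%fset -> E <> C -> phi E = [set (w * s)%g].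
  move=> Ec FE EC; have [SE _] := Ec; have [v Ev] := chamber_label Ec.
  have : phi E `<=` phi F by apply/phi_rev => //; apply: face_simplex SC FC.1.
  rewrite Ev Fws => /(_ _ erefl)[] /= vw; last by rewrite vw.
  by case: EC; apply: phi_inj => //; rewrite Ev Cw vw.
by apply: phi_inj; [exact: Dc.1|exact: D'c.1|rewrite !lbl].
Qed.

(** The labels identify the dual graph of an apartment with the Cayley graph
    of (W, S): crossing a panel multiplies the label on the right by a
    generator. *)
Lemma dual_cayley_adjacent C D w v : chamber Sigma C -> chamber Sigma D ->
  phi C = [set w] -> phi D = [set v] ->
  adjacent (dual_graph Sigma) C D <-> adjacent (cayley_graph S) w v.
Proof.
move=> Cc Dc Cw Dv; have [SC _] := Cc; have [SD _] := Dc; split.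
  move=> [_ _ CD [F [FC FD]]].
  have wv : w <> v by move=> wv; apply: CD; apply: phi_inj; rewrite // Cw Dv wv.
  split=> //; have [s Ss Fws] := panel_label SC Cw FC; exists s => //; left.
  have SF := face_simplex SC FC.1.
  have : phi D `<=` phi F by apply/phi_rev => //; apply: FD.1.
  by rewrite Dv Fws => /(_ _ erefl)[] // vw; case: wv.
move=> [wv [s Ss wvs]]; split=> //.
  move=> CD; apply: wv; have : phi C w by rewrite Cw.
  by rewrite CD Dv.
have [ss _] := involution (S2 Ss).
have vE : v = (w * s)%g by case: wvs => // ->; rewrite -mulgA ss mulg1.
have [F FC Fws] := label_panel SC Cw Ss.
have [G GD Gvs] := label_panel SD Dv Ss.
exists F; split=> //; suff -> : F = G by [].
apply: phi_inj; [exact: face_simplex SC FC.1|exact: face_simplex SD GD.1|].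
by rewrite Fws Gvs vE -mulgA ss mulg1 setUC.
Qed.

Lemma dual_to_cayley n C D w v : chamber Sigma C -> phi C = [set w] ->
  phi D = [set v] -> walk (dual_graph Sigma) n C D -> walk (cayley_graph S) n w v.
Proof.
move=> + + Dv; elim: n C w => [|n IH] C w Cc Cw /=.
  by move=> CD; have : phi C w by [rewrite Cw]; rewrite CD Dv.
move=> [E CE ED]; have [_ Ec _ _] := CE; have [u Eu] := chamber_label Ec.
by exists u; [apply/(dual_cayley_adjacent Cc Ec Cw Eu)|apply: IH ED].
Qed.

Lemma cayley_to_dual n C D w v : chamber Sigma C -> chamber Sigma D ->
  phi C = [set w] -> phi D = [set v] -> walk (cayley_graph S) n w v ->
  walk (dual_graph Sigma) n C D.
Proof.
move=> + Dc + Dv; elim: n C w => [|n IH] C w Cc Cw /=.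
  by move=> wv; apply: phi_inj; [exact: Cc.1|exact: Dc.1|rewrite Cw Dv wv].
move=> [u wu uv]; have [E [SE Eu]] := chamber_of_label u.
have Ec := label_chamber SE Eu.
by exists E; [apply/(dual_cayley_adjacent Cc Ec Cw Eu)|apply: IH uv].
Qed.

Lemma apartment_connected : connected_graph (dual_graph Sigma).
Proof.
move=> C D Cc Dc; have [[w Cw] [v Dv]] := (chamber_label Cc, chamber_label Dc).
have [n wv] := cayley_connected Sgen (I : vertex (cayley_graph S) w)
  (I : vertex (cayley_graph S) v).
by exists n; apply: cayley_to_dual wv.
Qed.

Lemma apartment_gdist C D w v : chamber Sigma C -> chamber Sigma D ->
  phi C = [set w] -> phi D = [set v] ->
  gdist (dual_graph Sigma) C D = gdist (cayley_graph S) w v.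
Proof.
move=> Cc Dc Cw Dv; apply/eqP; rewrite eqn_leq; apply/andP; split; apply: gdist_le.
  by apply: cayley_to_dual Cw Dv _ => //; apply: (gdistP (cayley_connected Sgen)).
by apply: dual_to_cayley Cw Dv _ => //; apply: (gdistP apartment_connected).
Qed.

Lemma apartment_star H : vertex_star (cayley_graph S) H ->
  vertex_star (dual_graph Sigma) H.
Proof.
move=> star C D E P Cc Dc Ec Pc.
have [[c Cl] [d Dl]] := (chamber_label Cc, chamber_label Dc).
have [[e El] [p Pl]] := (chamber_label Ec, chamber_label Pc).
rewrite (apartment_gdist Cc Pc Cl Pl) (apartment_gdist Pc Dc Pl Dl).
rewrite (apartment_gdist Cc Dc Cl Dl) (apartment_gdist Ec Pc El Pl).
rewrite (apartment_gdist Cc Ec Cl El) (apartment_gdist Dc Pc Dl Pl).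
by rewrite (apartment_gdist Dc Ec Dl El); apply: star.
Qed.

End Apartment.

(** * Isomorphisms of complexes *)

Local Notation fimage f A := [fset f v | v in A]%fset.

Section Isomorphisms.
Variables (V : choiceType) (Sigma Sigma' : set {fset V}) (f : V -> V).
Hypotheses (Sigma_cplx : simplicial_complex Sigma)
  (Sigma'_cplx : simplicial_complex Sigma') (f_iso : complex_isomorphism Sigma Sigma' f).
Implicit Types (A B C D F : {fset V}).

Lemma simplex_vertex A v : Sigma A -> v \in A -> Sigma [fset v]%fset.
Proof. by move=> SA vA; apply: Sigma_cplx.2 SA _; rewrite fsub1set. Qed.

Lemma iso_vertex_inj A B u v : Sigma A -> Sigma B -> u \in A -> v \in B ->
  f u = f v -> u = v.
Proof.
move=> SA SB uA vB; apply: f_iso.1; apply: mem_set.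
  exact: simplex_vertex uA.
exact: simplex_vertex vB.
Qed.

Lemma iso_simplex A : Sigma A -> Sigma' (fimage f A).
Proof. by move=> SA; rewrite -f_iso.2; exists A. Qed.

Lemma iso_simplex_lift A' : Sigma' A' -> exists2 A, Sigma A & fimage f A = A'.
Proof. by rewrite -f_iso.2 => -[A SA <-]; exists A. Qed.

Lemma iso_subset A B : Sigma A -> Sigma B ->
  (fimage f A `<=` fimage f B)%fset = (A `<=` B)%fset.
Proof.
move=> SA SB; apply/idP/idP => [/fsubsetP fAB|/fsubsetP AB]; last first.
  by apply: subset_imfset => v /AB.
apply/fsubsetP => v vA.
have /imfsetP[u /= uB fvu] : f v \in fimage f B by apply/fAB/in_imfset.
by rewrite (iso_vertex_inj SA SB vA uB fvu).
Qed.

Lemma iso_simplex_inj A B : Sigma A -> Sigma B -> fimage f A = fimage f B -> A = B.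
Proof.
move=> SA SB fAB; apply/eqP.
by rewrite eqEfsubset -(iso_subset SA SB) -(iso_subset SB SA) fAB fsubset_refl.
Qed.

Lemma iso_card A : Sigma A -> #|` fimage f A| = #|` A|.
Proof.
move=> SA; rewrite card_in_imfset // => u v uA vA.
exact: iso_vertex_inj uA vA.
Qed.

Lemma iso_codim1 F C : Sigma C -> codim1_face F C ->
  codim1_face (fimage f F) (fimage f C).
Proof.
move=> SC [FC cFC]; have SF := Sigma_cplx.2 _ _ SC FC.
by split; [rewrite iso_subset|rewrite !iso_card].
Qed.

Lemma iso_chamber C : chamber Sigma C -> chamber Sigma' (fimage f C).
Proof.
move=> [SC Cmax]; split; first exact: iso_simplex.
move=> _ /iso_simplex_lift[D SD <-]; rewrite iso_subset // => CD.
by rewrite (Cmax D).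
Qed.

Lemma iso_chamber_lift C' : chamber Sigma' C' ->
  exists2 C, chamber Sigma C & fimage f C = C'.
Proof.
move=> [SC' C'max]; have [C SC fC] := iso_simplex_lift SC'; exists C => //.
split=> // D SD CD; apply: iso_simplex_inj => //; rewrite fC; apply: C'max.
  exact: iso_simplex.
by rewrite -fC iso_subset.
Qed.

Lemma iso_adjacent C D : adjacent (dual_graph Sigma) C D ->
  adjacent (dual_graph Sigma') (fimage f C) (fimage f D).
Proof.
move=> [Cc Dc CD [F [FC FD]]]; have [[SC _] [SD _]] := (Cc, Dc).
split; [exact: iso_chamber|exact: iso_chamber|by move/(iso_simplex_inj SC SD)|].
by exists (fimage f F); split; apply: iso_codim1.
Qed.

Lemma iso_adjacent_lift C D' : chamber Sigma C ->
  adjacent (dual_graph Sigma') (fimage f C) D' ->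
  exists2 D, adjacent (dual_graph Sigma) C D & fimage f D = D'.
Proof.
move=> Cc [_ D'c CD' [F' [F'C F'D]]]; have [SC _] := Cc.
have [D Dc fD] := iso_chamber_lift D'c; have [SD _] := Dc.
have [F SF fF] := iso_simplex_lift (Sigma'_cplx.2 _ _ D'c.1 F'D.1).
exists D => //; split=> //; first by move=> CD; apply: CD'; rewrite CD.
move: F'C F'D; rewrite -fD -fF => -[FC cFC] [FD cFD].
by exists F; rewrite !iso_card // in cFC cFD; rewrite !iso_subset // in FC FD.
Qed.

Lemma iso_walk_lift n C D : chamber Sigma C -> Sigma D ->
  walk (dual_graph Sigma') n (fimage f C) (fimage f D) ->
  walk (dual_graph Sigma) n C D.
Proof.
move=> + SD; elim: n C => [|n IH] C Cc /=.
  by apply: iso_simplex_inj => //; apply: Cc.1.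
move=> [E' /(iso_adjacent_lift Cc)[E CE <-] ED]; exists E => //.
by apply: IH => //; case: CE.
Qed.

End Isomorphisms.

Lemma fimage_fixed (V : choiceType) (f : V -> V) (A : {fset V}) :
  (forall v, v \in A -> f v = v) -> fimage f A = A.
Proof.
move=> fA; apply/fsetP => v; apply/imfsetP/idP => /= [[u uA ->]|vA].
  by rewrite fA.
by exists v => //; rewrite fA.
Qed.

Lemma fimage_comp (V : choiceType) (f g : V -> V) (A : {fset V}) :
  fimage (g \o f) A = fimage g (fimage f A).
Proof.
apply/fsetP=> x; apply/imfsetP/imfsetP => /= [[v vA ->]|[_ /imfsetP[v /= vA ->] ->]].
  by exists (f v) => //; apply: in_imfset.
by exists v.
Qed.

Lemma iso_comp (V : choiceType) (S1 S2 S3 : set {fset V}) (f g : V -> V) :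
  complex_isomorphism S1 S2 f -> complex_isomorphism S2 S3 g ->
  complex_isomorphism S1 S3 (g \o f).
Proof.
move=> [finj <-] [ginj <-]; split.
  move=> u v /set_mem uS /set_mem vS /= guv; apply: finj; try exact: mem_set.
  apply: ginj guv; apply: mem_set; rewrite /= -imfset_fset1.
    by exists [fset u]%fset.
  by exists [fset v]%fset.
apply/seteqP; split=> [_ [A SA <-]|_ [_ [A SA <-] <-]].
  by exists (fimage f A); [exists A|rewrite -fimage_comp].
by exists A => //; rewrite fimage_comp.
Qed.

Lemma iso_id (V : choiceType) (Sigma : set {fset V}) :
  complex_isomorphism Sigma Sigma id.
Proof.
split=> //; apply/seteqP; split=> [_ [A SA <-]|A SA].
  by rewrite fimage_fixed.
by exists A => //; rewrite fimage_fixed.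
Qed.

(** * Buildings *)

Section Building.
Variables (W : groupType) (S : set W) (V : choiceType) (Delta : set {fset V}).
Hypothesis Sgen : generated_subgroup S = [set: W].
Hypothesis S2 : forall s, S s -> has_order s 2.
Variable apartment : set (set {fset V}).
Hypotheses
  (ap_sub : forall Sigma, apartment Sigma -> subcomplex Sigma Delta)
  (ap_cox : forall Sigma, apartment Sigma -> isomorphic_to_coxeter_complex Sigma S)
  (ap_pair : forall A B, Delta A -> Delta B ->
     exists2 Sigma, apartment Sigma & Sigma A /\ Sigma B)
  (ap_iso : forall Sigma Sigma' A B, apartment Sigma -> apartment Sigma' ->
     Sigma A -> Sigma B -> Sigma' A -> Sigma' B ->
     exists2 f : V -> V, complex_isomorphism Sigma Sigma' f &
       forall v, v \in (A `|` B)%fset -> f v = v).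
Implicit Types (Sigma : set {fset V}) (A B C D E F X Y : {fset V}).

Let ap_cplx Sigma : apartment Sigma -> simplicial_complex Sigma.
Proof. by move=> /ap_sub[]. Qed.

Lemma ap_iso_fix Sigma Sigma' A B : apartment Sigma -> apartment Sigma' ->
  Sigma A -> Sigma B -> Sigma' A -> Sigma' B ->
  exists f : V -> V, [/\ complex_isomorphism Sigma Sigma' f,
    forall v, v \in A -> f v = v & forall v, v \in B -> f v = v].
Proof.
move=> a a' SA SB S'A S'B; have [f fiso ffix] := ap_iso a a' SA SB S'A S'B.
by exists f; split=> // v vAB; apply: ffix; rewrite inE vAB ?orbT.
Qed.

(** Maximality in one apartment implies maximality in the building: a larger
    simplex D lies in an apartment that also contains C, and the isomorphism that
    fixes C moves D into Sigma without changing its size. *)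
Lemma ap_chamber Sigma C : apartment Sigma -> chamber Sigma C -> chamber Delta C.
Proof.
move=> a [SC Cmax]; split; first by apply: (ap_sub a).2.
move=> D DD CD; have [Sigma' a' [S'C S'D]] := ap_pair ((ap_sub a).2 _ SC) DD.
have [f [fiso ffix _]] := ap_iso_fix a' a S'C S'C SC SC.
have a'cplx := ap_cplx a'.
have fDC : fimage f D = C.
  apply: Cmax; first exact: (iso_simplex fiso).
  by rewrite -{1}(fimage_fixed ffix) (iso_subset a'cplx fiso).
apply/esym/fsubset_eq_card => //.
by rewrite -(iso_card a'cplx fiso S'D) fDC.
Qed.

Lemma chamber_ap Sigma C : apartment Sigma -> chamber Delta C -> Sigma C ->
  chamber Sigma C.
Proof.
by move=> a [_ Cmax] SC; split=> // D /(ap_sub a).2; apply: Cmax.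
Qed.

Lemma ap_adjacent Sigma C D : apartment Sigma ->
  adjacent (dual_graph Sigma) C D -> adjacent (dual_graph Delta) C D.
Proof. by move=> a [Cc Dc CD FCD]; split=> //; apply: ap_chamber a _. Qed.

Lemma ap_walk Sigma n C D : apartment Sigma ->
  walk (dual_graph Sigma) n C D -> walk (dual_graph Delta) n C D.
Proof.
move=> a; elim: n C => [//|n IH] C /= [E CE /IH ED].
by exists E => //; apply: ap_adjacent CE.
Qed.

Lemma ap_connected Sigma : apartment Sigma -> connected_graph (dual_graph Sigma).
Proof.
move=> a; have [phi phib phir] := ap_cox a.
exact: (apartment_connected Sgen S2 (ap_cplx a) phib phir).
Qed.

Lemma building_connected : connected_graph (dual_graph Delta).
Proof.
move=> C D Cc Dc; have [Sigma a [SC SD]] := ap_pair Cc.1 Dc.1.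
have [n CD] := ap_connected a (chamber_ap a Cc SC) (chamber_ap a Dc SD).
by exists n; apply: ap_walk CD.
Qed.

Lemma ap_thin_exists Sigma F C : apartment Sigma -> chamber Sigma C ->
  codim1_face F C -> exists D, [/\ chamber Sigma D, D <> C & codim1_face F D].
Proof.
move=> a; have [phi phib phir] := ap_cox a.
exact: (thin_exists S2 (ap_cplx a) phib phir).
Qed.

Lemma ap_thin_unique Sigma F C D D' : apartment Sigma -> chamber Sigma C ->
  chamber Sigma D -> chamber Sigma D' -> codim1_face F C ->
  (F `<=` D)%fset -> (F `<=` D')%fset -> D <> C -> D' <> C -> D = D'.
Proof.
move=> a; have [phi phib phir] := ap_cox a.
exact: (thin_unique S2 (ap_cplx a) phib phir).
Qed.

(** Isomorphisms between apartments are rigid: by thinness, agreement on a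
    chamber propagates across each of its panels. *)
Lemma iso_rigid_step Sigma Sigma' f g C D : apartment Sigma -> apartment Sigma' ->
  complex_isomorphism Sigma Sigma' f -> complex_isomorphism Sigma Sigma' g ->
  adjacent (dual_graph Sigma) C D -> {in C, f =1 g} -> {in D, f =1 g}.
Proof.
move=> a a' fiso giso [Cc Dc CD [F [FC FD]]] fgC.
have [[SC _] [SD _]] := (Cc, Dc).
have cplx := ap_cplx a; have SF := cplx.2 _ _ SC FC.1.
have fgC' : fimage f C = fimage g C by apply: eq_in_imfset.
have fgF : {in F, f =1 g} by move=> v /(fsubsetP FC.1); apply: fgC.
have fgF' : fimage f F = fimage g F by apply: eq_in_imfset.
have fgD : fimage f D = fimage g D.
  apply: (ap_thin_unique a' (iso_chamber cplx fiso Cc) (iso_chamber cplx fiso Dc)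
    (iso_chamber cplx giso Dc) (iso_codim1 cplx fiso SC FC)).
  - by rewrite (iso_subset cplx fiso) //; apply: FD.1.
  - by rewrite fgF' (iso_subset cplx giso) //; apply: FD.1.
  - by move/(iso_simplex_inj cplx fiso SD SC)/esym.
  - by rewrite fgC' => /(iso_simplex_inj cplx giso SD SC)/esym.
move=> v vD; have [vF|vF] := boolP (v \in F); first exact: fgF.
have : f v \in fimage g D by rewrite -fgD; apply: in_imfset.
move=> /imfsetP[u /= uD fvu]; rewrite fvu.
have [uF|uF] := boolP (u \in F).
  have fvu' : f v = f u by rewrite fvu fgF.
  by case/negP: vF; rewrite (iso_vertex_inj cplx fiso SD SD vD uD fvu').
(* D has only one vertex outside F *)
have /eqP/cardfs1P[x Dx] : #|` (D `\` F)%fset| = 1.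
  by rewrite cardfsDS ?FD.1 // FD.2 subSnn.
have : v \in (D `\` F)%fset by rewrite inE vF.
have : u \in (D `\` F)%fset by rewrite inE uF.
by rewrite Dx !inE => /eqP -> /eqP ->.
Qed.

Lemma iso_rigid Sigma Sigma' f g C A : apartment Sigma -> apartment Sigma' ->
  complex_isomorphism Sigma Sigma' f -> complex_isomorphism Sigma Sigma' g ->
  chamber Sigma C -> {in C, f =1 g} -> Sigma A -> fimage f A = fimage g A.
Proof.
move=> a a' fiso giso Cc fgC SA; have [phi phib phir] := ap_cox a.
have [D [Dc AD]] := simplex_in_chamber phib phir SA.
have [n CD] := ap_connected a Cc Dc.
suff fgD : {in D, f =1 g}.
  by apply: eq_in_imfset => v /= /(fsubsetP AD); apply: fgD.
elim: n C CD Cc fgC => [|n IH] C /=; first by move=> ->.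
move=> [E CE ED] Cc fgC; apply: (IH E) => //; first by case: CE.
exact: (iso_rigid_step a a' fiso giso CE).
Qed.

(** The retraction of the building onto the apartment Sigma centred at its chamber
    P, given as a relation since it is built from chosen apartments and
    isomorphisms; it is functional by rigidity. *)
Definition retracts Sigma P X Y : Prop := exists Sigma' f,
  [/\ apartment Sigma', Sigma' P /\ Sigma' X, complex_isomorphism Sigma' Sigma f,
      forall v, v \in P -> f v = v & Y = fimage f X].

Section Retraction.
Variables (Sigma : set {fset V}) (P : {fset V}).
Hypotheses (a : apartment Sigma) (Pc : chamber Sigma P).

Let SP : Sigma P := Pc.1.
Let PD : Delta P := (ap_sub a).2 _ SP.

Lemma retracts_total X : Delta X -> exists Y, retracts Sigma P X Y.
Proof.
move=> DX; have [Sigma' a' [S'P S'X]] := ap_pair PD DX.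
have [f [fiso ffix _]] := ap_iso_fix a' a S'P S'P SP SP.
by exists (fimage f X), Sigma', f.
Qed.

(** The two apartments used both contain P and X, so an isomorphism between them fixes
    both; by rigidity it commutes with the two maps to Sigma, which agree on
    P. *)
Lemma retracts_fun X Y Y' : retracts Sigma P X Y -> retracts Sigma P X Y' -> Y = Y'.
Proof.
move=> [S1 [f [a1 [S1P S1X] fiso ffix ->]]] [S3 [g [a3 [S3P S3X] giso gfix ->]]].
have [h [hiso hP hX]] := ap_iso_fix a1 a3 S1P S1X S3P S3X.
have P1c : chamber S1 P by apply: chamber_ap => //; apply: ap_chamber a Pc.
rewrite (iso_rigid a1 a fiso (iso_comp hiso giso) P1c _ S1X).
  by rewrite fimage_comp (fimage_fixed hX).
by move=> v vP /=; rewrite hP // ffix // gfix.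
Qed.

Lemma retracts_id X : Sigma X -> retracts Sigma P X X.
Proof.
by move=> SX; exists Sigma, id; rewrite fimage_fixed; split=> //; apply: iso_id.
Qed.

Lemma retracts_chamber C Y : chamber Delta C -> retracts Sigma P C Y ->
  chamber Sigma Y.
Proof.
move=> Cc [S' [f [a' [_ S'C] fiso _ ->]]].
by apply: (iso_chamber (ap_cplx a') fiso); apply: chamber_ap.
Qed.

Lemma retracts_face F C Y : codim1_face F C -> retracts Sigma P C Y ->
  exists2 F', retracts Sigma P F F' & codim1_face F' Y.
Proof.
move=> FC [S' [f [a' [S'P S'C] fiso ffix ->]]]; exists (fimage f F).
  by exists S', f; split=> //; split=> //; apply: (ap_cplx a').2 S'C FC.1.
exact: (iso_codim1 (ap_cplx a') fiso).
Qed.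

(** Adjacent chambers share a panel, whose image does not depend on the chamber
    through which it is computed. *)
Lemma retracts_adjacent C D C' D' : adjacent (dual_graph Delta) C D ->
  retracts Sigma P C C' -> retracts Sigma P D D' ->
  C' = D' \/ adjacent (dual_graph Sigma) C' D'.
Proof.
move=> [Cc Dc _ [F [FC FD]]] CC' DD'.
have [F1 FF1 FC'] := retracts_face FC CC'.
have [F2 FF2 FD'] := retracts_face FD DD'.
have [CD'|CD'] := pselect (C' = D'); [by left|right; split=> //].
- exact: retracts_chamber CC'.
- exact: retracts_chamber DD'.
- by exists F1; split=> //; rewrite (retracts_fun FF1 FF2).
Qed.

Lemma retracts_gdist C D C' D' : chamber Delta C -> chamber Delta D ->
  retracts Sigma P C C' -> retracts Sigma P D D' ->
  gdist (dual_graph Sigma) C' D' <= gdist (dual_graph Delta) C D.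
Proof.
move=> Cc Dc + DD'; have := gdistP building_connected Cc Dc.
move: (gdist _ C D) => n; elim: n C C' {Cc} => [|n IH] C C' /=.
  by move=> -> /(retracts_fun DD') ->; rewrite gdistxx.
move=> [E CE ED] CC'; have [_ Ec _ _] := CE.
have [E' EE'] := retracts_total Ec.1.
have C'c : chamber Sigma C' by apply: retracts_chamber CC'; case: CE.
have E'c := retracts_chamber Ec EE'; have D'c : chamber Sigma D'.
  by apply: retracts_chamber DD'; apply: (walk_vertex (@dual_graph_simple _ _) ED).
apply: leq_trans (gdist_triangle (ap_connected a) C'c E'c D'c) _.
have := IH _ _ ED EE'; have [<-|C'E'] := retracts_adjacent CE CC' EE'.
  by rewrite gdistxx; lia.
by rewrite (gdist_adj (@dual_graph_simple _ _) (ap_connected a) C'E'); lia.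
Qed.

(** The retraction onto an apartment fixes it and does not increase distances, so no
    gallery outside the apartment is a shortcut. *)
Lemma ap_gdist C D : chamber Sigma C -> chamber Sigma D ->
  gdist (dual_graph Delta) C D = gdist (dual_graph Sigma) C D.
Proof.
move=> Cc Dc; apply/eqP; rewrite eqn_leq; apply/andP; split.
  by apply: gdist_le; apply: (ap_walk a); apply: (gdistP (ap_connected a)).
apply: retracts_gdist; try exact: ap_chamber a _.
  exact: retracts_id Cc.1.
exact: retracts_id Dc.1.
Qed.

(** An apartment containing P and C embeds isometrically, and is mapped
    isomorphically onto Sigma. *)
Lemma retracts_gdist_centre C C' : chamber Delta C -> retracts Sigma P C C' ->
  gdist (dual_graph Delta) P C = gdist (dual_graph Sigma) P C'.
Proof.
move=> Cc CC'; apply/eqP; rewrite eqn_leq; apply/andP; split; last first.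
  by apply: retracts_gdist => //; [exact: ap_chamber a Pc|exact: retracts_id].
have C'c := retracts_chamber Cc CC'.
case: CC' C'c => S' [f [a' [S'P S'C] fiso ffix ->]] C'c.
apply: gdist_le; apply: (ap_walk a').
apply: (iso_walk_lift (ap_cplx a') (ap_cplx a) fiso) => //.
  by apply: (chamber_ap a') => //; apply: ap_chamber a Pc.
by rewrite (fimage_fixed ffix); apply: (gdistP (ap_connected a)).
Qed.

End Retraction.

(** Convexity of apartments, one step at a time: if the first step of a geodesic left
    the apartment through a panel F of x, then the retraction centred at the other chamber of the apartment at F would
    fold this step, and shorten the geodesic. *)
Lemma ap_convex_step Sigma x y z : apartment Sigma -> chamber Sigma x ->
  chamber Sigma y -> adjacent (dual_graph Delta) x z ->
  gdist (dual_graph Delta) z y < gdist (dual_graph Delta) x y -> Sigma z.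
Proof.
move=> a xc yc xz zy; apply: contrapT => zS.
have [_ zc _ [F [Fx Fz]]] := xz.
have [P [Pc Px FP]] := ap_thin_exists a xc Fx.
have [z' zz'] := retracts_total a Pc zc.1.
have z'c := retracts_chamber zc zz'.
have SF := (ap_cplx a).2 _ _ xc.1 Fx.1.
have Fz' : (F `<=` z')%fset.
  have [F' FF' [F'z' _]] := retracts_face Fz zz'.
  by rewrite -(retracts_fun a Pc FF' (retracts_id a Pc SF)).
have z'P : z' <> P.
  move=> z'P; have := retracts_gdist_centre a Pc zc zz'.
  rewrite z'P gdistxx => /(gdist_eq0 building_connected (ap_chamber a Pc) zc) Pz.
  by apply: zS; rewrite -Pz; apply: Pc.1.
have z'x : z' = x.
  exact: (ap_thin_unique a Pc z'c xc FP Fz' Fx.1 z'P (nesym Px)).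
have := retracts_gdist a Pc zc (ap_chamber a yc) zz' (retracts_id a Pc yc.1).
by rewrite z'x -(ap_gdist a Pc xc yc); lia.
Qed.

Lemma ap_convex Sigma x y p : apartment Sigma -> chamber Sigma x ->
  chamber Sigma y -> chamber Delta p ->
  gdist (dual_graph Delta) x p + gdist (dual_graph Delta) p y =
  gdist (dual_graph Delta) x y -> Sigma p.
Proof.
move=> a xc yc pc.
have := gdistP building_connected (ap_chamber a xc) pc.
move: (gdist _ x p) => k; elim: k x xc => [|k IH] x xc /=.
  by move=> <- _; apply: xc.1.
move=> [z xz zp] xpy; have zc : chamber Delta z by case: xz.
have tri := gdist_triangle building_connected.
have DDs := @dual_graph_simple _ Delta.
have yDc := ap_chamber a yc; have xDc := ap_chamber a xc.
have xz1 := gdist_adj DDs building_connected xz.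
have := tri _ _ _ xDc zc yDc; have := tri _ _ _ zc pc yDc.
have zpk := gdist_le zp; rewrite xz1 => zy xy.
have Sz : Sigma z by apply: (ap_convex_step a xc yc xz); lia.
by apply: (IH z (chamber_ap a zc Sz) zp); lia.
Qed.

(** Retracting onto an apartment containing x, p and y from the centre p keeps
    the distances of p and does not increase those of x and y. *)
Lemma building_star H : vertex_star (cayley_graph S) H ->
  vertex_star (dual_graph Delta) H.
Proof.
move=> star x y z p xc yc zc pc xpy.
have [Sigma a [Sx Sy]] := ap_pair xc.1 yc.1.
have [x'c y'c] := (chamber_ap a xc Sx, chamber_ap a yc Sy).
have p'c := chamber_ap a pc (ap_convex a x'c y'c pc xpy).
have [z' zz'] := retracts_total a p'c zc.1.
have z'c := retracts_chamber zc zz'.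
have [phi phib phir] := ap_cox a.
have := apartment_star Sgen S2 (ap_cplx a) phib phir star.
move=> /(_ x y z' p x'c y'c z'c p'c).
rewrite -!(ap_gdist a p'c) // => /(_ xpy).
have DDs := @dual_graph_simple _ Delta.
have := retracts_gdist_centre a p'c zc zz'; rewrite -(ap_gdist a p'c) //.
rewrite (gdistC DDs building_connected pc zc).
rewrite (gdistC DDs building_connected pc (ap_chamber a z'c)) => ->.
have := retracts_gdist a p'c xc zc (retracts_id a p'c Sx) zz'.
have := retracts_gdist a p'c yc zc (retracts_id a p'c Sy) zz'.
rewrite -!(ap_gdist a p'c) // => yz xz [near|near]; [left|right];
  by apply: leq_trans near _; rewrite leq_add2r.
Qed.

End Building.

(** * The dual graph of a building *)

Theorem theorem1 (R : realType) (W : groupType) (S : set W) (V : choiceType)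
    (Delta : set {fset V}) :
  coxeter_system S ->
  word_hyperbolic R W ->
  building Delta S ->
  hyperbolic (path_dist R (dual_graph Delta)).
Proof.
move=> [Sfin Sgen S2 _] Whyp [cplx [apartment [ap_sub _ ap_cox ap_pair ap_iso]]].
have [H star] := word_hyperbolic_star Whyp Sfin Sgen.
have simple := @dual_graph_simple _ Delta.
have conn := building_connected Sgen S2 ap_sub ap_cox ap_pair ap_iso.
split; first exact: path_dist_geodesic_space.
have Dstar := building_star Sgen S2 ap_sub ap_cox ap_pair ap_iso star.
exists (2 * (H%:R + 6))%R; apply: star_thin_triangle.
  exact: path_dist_metric.
exact: star_of_vertices.
Qed.
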